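(* Let $\langle k_n,l_n:n\in\mathbb N\rangle$ be positive integers with $k_n\ge2$ for all $n$ and $\sum_n 1/l_n<\infty$. Then $\alpha_n=p_n/q_n$ converges to an irrational number $\alpha$, and, letting $\nu$ be the unique non-atomic shift-invariant Borel probability measure on the circle factor $\mathcal K$, the system $(\mathcal K,\nu,sh)$ is measure-theoretically isomorphic to $(S^1,\lambda,\mathcal R_\alpha)$, where $\lambda$ is Lebesgue measure and $\mathcal R_\alpha$ is rotation by $\alpha$ (identifying $S^1$ with $[0,1)$ and $\mathcal R_\alpha x=x+\alpha\bmod1$).
   Context: Circular operator: let $k,l,p,q$ be positive integers with $p,q$ coprime. For $0\le i<q$ let $j_i\in\{0,\dots,q-1\}$ be the unique integer with $j_i\equiv p^{-1}i\pmod q$. For words $w_0,\dots,w_{k-1}$ over an alphabet $\Sigma\cup\{b,e\}$ (where $b,e\notin\Sigma$) define $\mathcal C(w_0,\dots,w_{k-1})=\prod_{i=0}^{q-1}\prod_{j=0}^{k-1} b^{q-j_i}w_j^{\,l-1}e^{j_i}$ (concatenation in increasing order of indices). Coefficients: $p_0=0$, $q_0=1$, $p_{n+1}=p_nq_nk_nl_n+1$, $q_{n+1}=k_nl_nq_n^2$, $\alpha_n=p_n/q_n$; $\mathcal C_n$ is $\mathcal C$ with $k=k_n,l=l_n,p=p_n,q=q_n$. Circle factor: with alphabet $\{*\}$, let $w_0=*$ and $w_{n+1}=\mathcal C_n(w_n,w_n,\dots,w_n)$ ($k_n$ entries). $\mathcal K$ is the set of $x\in\{*,b,e\}^{\mathbb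 Z}$ every finite block of which occurs as a subword of some $w_n$, with shift $sh(x)(n)=x(n+1)$. *)

(* Defs.v *)
From HB Require Import structures.
From mathcomp Require Import all_boot all_order all_algebra.
From mathcomp Require Import all_classical all_reals all_analysis.

Set Implicit Arguments.
Unset Strict Implicit.
Unset Printing Implicit Defensive.

Import Order.TTheory GRing.Theory Num.Theory.
Local Open Scope classical_set_scope.

Inductive sym := Star | Bsym | Esym.

Definition sym_to_ord (s : sym) : 'I_3 :=
  match s with Star => inord 0 | Bsym => inord 1 | Esym => inord 2 end.
Definition ord_to_sym (i : 'I_3) : sym :=
  match val i with 0 => Star | 1 => Bsym | _ => Esym end.
Lemma sym_to_ordK : cancel sym_to_ord ord_to_sym.
Proof. by case; rewrite /ord_to_sym /= inordK. Qed.

HB.instance Definition _ := Equality.copy sym (can_type sym_to_ordK).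
HB.instance Definition _ := Choice.copy sym (can_type sym_to_ordK).
HB.instance Definition _ := Countable.copy sym (can_type sym_to_ordK).
HB.instance Definition _ := isPointed.Build sym Star.

(* j_i : the unique j in {0,..,q-1} with j = p^{-1} i (mod q), i.e.
   p * j = i (mod q); found by search (p, q coprime). *)
Definition circ_j (p q i : nat) : nat :=
  find (fun j => (p * j) %% q == i %% q) (iota 0 q).

Definition circular (k l p q : nat) (ws : seq (seq sym)) : seq sym :=
  flatten [seq flatten [seq nseq (q - circ_j p q i) Bsym
                            ++ flatten (nseq (l - 1) (nth [::] ws j))
                            ++ nseq (circ_j p q i) Esym
                       | j <- iota 0 k]
          | i <- iota 0 q].

Fixpoint coef_pq (k l : nat -> nat) (n : nat) : nat * nat :=
  match n with
  | 0 => (0, 1)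
  | n'.+1 => let: (pn, qn) := coef_pq k l n' in
             (pn * qn * k n' * l n' + 1, k n' * l n' * qn ^ 2)
  end.
Definition coef_p k l n := (coef_pq k l n).1.
Definition coef_q k l n := (coef_pq k l n).2.

Definition alpha_n {R : realType} (k l : nat -> nat) (n : nat) : R :=
  ((coef_p k l n)%:R / (coef_q k l n)%:R)%R.

Fixpoint circ_word (k l : nat -> nat) (n : nat) : seq sym :=
  match n with
  | 0 => [:: Star]
  | n'.+1 => circular (k n') (l n') (coef_p k l n') (coef_q k l n')
               (nseq (k n') (circ_word k l n'))
  end.

Definition bisequence := (int -> sym)%type.

Definition block (x : bisequence) (m : int) (len : nat) : seq sym :=
  [seq x (m + (i%:Z))%R | i <- iota 0 len].

(* Measurable structure on {*,b,e}^Z: sigma-algebra generated by the   *)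
(* cylinders {x | x i = a}, i.e. the Borel sigma-algebra of the        *)
(* product topology (countable product of finite discrete spaces).     *)
Definition cylinders : set (set bisequence) :=
  [set A | exists (i : int) (a : sym), A = [set x : bisequence | x i = a]].

Definition symZ := g_sigma_algebraType cylinders.

Definition circle_factor (k l : nat -> nat) : set symZ :=
  [set x | forall (m : int) (len : nat),
       exists n, infix (block x m len) (circ_word k l n)].

Definition sh (x : bisequence) : bisequence := fun n => x (n + 1)%R.

Definition unit_interval {R : realType} : set (measurableTypeR R) :=
  [set x | (0 <= x)%R /\ (x < 1)%R].

Definition rotation {R : realType} (a : R) (x : R) : R :=
  (x + a - (Num.floor (x + a))%:~R)%R.

Local Open Scope ring_scope.
Definition nonatomic_shift_invariant_prob {R : realType}
    (K : set symZ) (nu : {measure set symZ -> \bar R}) : Prop :=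
  [/\ nu setT = 1%E, nu K = 1%E,
      (forall A : set symZ, measurable A -> nu (sh @^-1` A) = nu A)
    & (forall x : symZ, nu [set x] = 0%E)].

Definition mt_isomorphic {R : realType} {d1 d2 : measure_display}
    {X : measurableType d1} {Y : measurableType d2}
    (Xs : set X) (mu : set X -> \bar R) (T : X -> X)
    (Ys : set Y) (lam : set Y -> \bar R) (S : Y -> Y) : Prop :=
  exists (X0 : set X) (Y0 : set Y) (phi : X -> Y) (psi : Y -> X),
    [/\ [/\ X0 `<=` Xs, Y0 `<=` Ys, measurable X0 & measurable Y0],
        mu (~` X0) = 0%E /\ lam (~` Y0) = 0%E,
        (forall x, X0 x -> X0 (T x)) /\ (forall y, Y0 y -> Y0 (S y)),
        [/\ (forall x, X0 x -> Y0 (phi x)), (forall y, Y0 y -> X0 (psi y)),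
            (forall x, X0 x -> psi (phi x) = x) &
            (forall y, Y0 y -> phi (psi y) = y)] &
        [/\ measurable_fun X0 phi, measurable_fun Y0 psi,
            (forall B : set Y, measurable B ->
                 mu (X0 `&` phi @^-1` B) = lam (Y0 `&` B)) &
            (forall x, X0 x -> phi (T x) = S (phi x))]].

Definition lebesgue_circle {R : realType} (A : set (measurableTypeR R)) : \bar R :=
  lebesgue_measure (A `&` unit_interval).

(* Main.v *)
Require Import Defs.
From HB Require Import structures.
From mathcomp Require Import all_boot all_order all_algebra.
From mathcomp Require Import all_classical all_reals all_analysis.
From mathcomp Require Import measurable_realfun.
From mathcomp Require Import zify ring lra.
Import Order.TTheory GRing.Theory Num.Theory.
Import numFieldNormedType.Exports.
Set Implicit Arguments.
Unset Strict Implicit.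
Unset Printing Implicit Defensive.
Local Open Scope classical_set_scope.
Local Open Scope ring_scope.

(* Position [s] of the word [w_n] lies over the arc of length [1/q_n] starting at
   [s p_n / q_n].  Since [p_(n+1) = p_n q_n k_n l_n + 1], the arcs of level n+1
   refine those of level n, and the letters of [w_(n+1)] and [w_n] over a point
   agree unless the point lies in the first or the last of the [l_n] pieces of
   its level-n subarc.  By Borel-Cantelli almost every point of the circle avoids
   these pieces at all high levels; its orbit then has an itinerary [coding th],
   which belongs to the circle factor.

   Conversely, the block [e b^h] not followed by [b], with [h] one more than the
   number of leading [b]'s of [w_n], occurs in longer words only over one arc of
   length [1/q_n].  A sequence of the circle factor containing such blocks of
   arbitrarily high level therefore determines a point [angle x] of the circle,
   and the shift becomes the rotation.

   A nonatomic invariant measure does not charge the sequences that have only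
   the transitions ee, eb, bb on one side.  For the other sequences, index 0 lies
   in boundary letters of only finitely many levels, which yields
   [x = coding (angle x)] as soon as [angle x] is generic.  The image of the
   measure under [angle] is rotation invariant, hence Lebesgue measure. *)

(** * Arithmetic of the circular operator *)

(** One-sided tails are null because the shift maps such sets to one another: they form a monotone
    sequence of sets of equal measure, so this measure is that of the intersection, which consists
    of countably many sequences and is null without atoms.

    Unique ergodicity of the rotation comes from the rational approximation. Since alpha - alpha_n
    is at most 2 / q_(n+1), every orbit meets each interval of length (1 + 2 / l_n) / q_n within q_n
    steps. In the limit an invariant measure gives every interval at least its length, and the lower
    bounds for two complementary intervals add up to the total mass.

    Summability of 1 / l_n is used for Borel-Cantelli, for l_n tending to infinity in this estimate,
    and for l_n >= 2 at high levels, where cells then contain copies of w_n. The bound k_n >= 2 puts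
    two cells with the same j_i side by side, and this makes the distinguished block e b^h occur.

    Existence and uniqueness of the measure come together: the image of Lebesgue measure under
    [coding] qualifies, and any other candidate equals it. *)

Lemma circ_j_spec p q i : (0 < q)%N -> coprime p q ->
  (circ_j p q i < q)%N /\ p * circ_j p q i = i %[mod q].
Proof.
move=> q0 cop.
have hasj : has (fun j => (p * j) %% q == i %% q)%N (iota 0 q).
  apply/hasP; move: cop; have [->|p0] := posnP p => cop.
    (* Level 0 has [p = 0]; coprimality then forces [q = 1]. *)
    move: cop; rewrite /coprime gcd0n => /eqP ->.
    by exists 0%N => //; rewrite !modn1.
  case: (egcdnP q p0) => u v Duv _.
  exists ((u * i) %% q)%N; first by rewrite mem_iota add0n ltn_pmod.
  rewrite modnMmr mulnA [(p * u)%N]mulnC Duv (eqP cop).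
  by rewrite mulnDl mul1n -mulnA [(q * i)%N]mulnC mulnA modnMDl.
have Hlt : (circ_j p q i < q)%N by move: hasj; rewrite has_find size_iota.
split=> //; have := nth_find 0%N hasj; rewrite -/(circ_j p q i).
by rewrite nth_iota // add0n => /eqP.
Qed.

Lemma modn_mul_inj p q a b : coprime p q -> (a < q)%N -> (b < q)%N ->
  p * a = p * b %[mod q] -> a = b.
Proof.
move=> cop; wlog ab : a b / (a <= b)%N.
  move=> H aq bq e; case: (leqP a b) => [|/ltnW] ba; first exact: H.
  by apply/esym/H.
move=> aq bq /eqP; rewrite eq_sym eqn_mod_dvd ?leq_mul // -mulnBr Gauss_dvdr 1?coprime_sym //.
case: (posnP (b - a)%N) => [ab0 _|ba /(dvdn_leq ba)]; lia.
Qed.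

Lemma circ_j_uniq p q i j : (0 < q)%N -> coprime p q ->
  (j < q)%N -> p * j = i %[mod q] -> circ_j p q i = j.
Proof.
move=> q0 cop jq pj; have [cq pc] := circ_j_spec i q0 cop.
by apply: (modn_mul_inj cop) => //; rewrite pc pj.
Qed.

Lemma nth_flatten_const (T : Type) (x0 : T) (F : nat -> seq T) c n i r :
  (forall m, (m < n)%N -> size (F m) = c) -> (i < n)%N -> (r < c)%N ->
  nth x0 (flatten [seq F m | m <- iota 0 n]) (i * c + r) = nth x0 (F i) r.
Proof.
elim: n F i => // n IH F i sF iln rc /=.
rewrite nth_cat sF //; case: i iln => [|i] iln; first by rewrite mul0n add0n rc.
rewrite ifF; last by apply/negbTE; rewrite -leqNgt mulSn -addnA leq_addr.
have -> : (i.+1 * c + r - c = i * c + r)%N by rewrite mulSn -addnA addKn.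
have -> : [seq F m | m <- iota 1 n] = [seq F m.+1 | m <- iota 0 n].
  by rewrite (iotaDl 1 0) -map_comp.
by rewrite IH // => m mn; rewrite sF.
Qed.

Lemma size_flatten_const (T : Type) (F : nat -> seq T) c n :
  (forall m, (m < n)%N -> size (F m) = c) ->
  size (flatten [seq F m | m <- iota 0 n]) = (n * c)%N.
Proof.
move=> sF; rewrite size_flatten /shape -map_comp sumnE big_map.
rewrite (eq_big_seq (fun=> c)); last by move=> m; rewrite mem_iota => /andP[_]; apply: sF.
by rewrite big_const_seq count_predT size_iota iter_addn_0 mulnC.
Qed.

(* The pairs of consecutive letters that occur in words of the form e..eb..b. *)
Definition okp a b := match a, b with
  | Esym, Esym | Esym, Bsym | Bsym, Bsym => true | _, _ => false end.

(** * The circle R/Z *)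

Section CircleDistance.
Variable R : realType.
Implicit Types x y z e d : R.

(** Distance on R/Z as a relation: no minimum over [z] is computed, and estimates chain by the
    triangle inequality. *)
Definition cnear x y e := exists z : int, `|x - y - z%:~R| <= e.

Lemma cnear_sym x y e : cnear x y e -> cnear y x e.
Proof.
case=> z h; exists (- z); rewrite mulrNz.
by rewrite -normrN (_ : - (_ - _) = x - y - z%:~R) //; ring.
Qed.

Lemma cnear_trans x y z e d : cnear x y e -> cnear y z d -> cnear x z (e + d).
Proof.
move=> [a ha] [b hb]; exists (a + b).
rewrite (_ : _ - _ = (x - y - a%:~R) + (y - z - b%:~R)); last by rewrite intrD; ring.
exact: le_trans (ler_normD _ _) (lerD ha hb).
Qed.

Lemma cnear_le x y e d : e <= d -> cnear x y e -> cnear x y d.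
Proof. by move=> ed [z hz]; exists z; apply: le_trans ed. Qed.

Lemma cnear_norm x y : cnear x y `|x - y|.
Proof. by exists 0; rewrite subr0. Qed.

Lemma cnearD x y z e : cnear x y e -> cnear (x + z) (y + z) e.
Proof. by case=> a ha; exists a; rewrite (_ : x + z - (y + z) = x - y) //; ring. Qed.

Lemma cnear_shift x y z e : cnear (x + z) y e -> cnear x (y - z) e.
Proof. by move=> /(cnearD (- z)); rewrite addrK. Qed.

Lemma cnear_int x y (z : int) : x = y + z%:~R -> cnear x y 0.
Proof. by move=> ->; exists z; rewrite (_ : y + _ - y - _ = 0) ?normr0 //; ring. Qed.

(** Since [y] keeps distance [e] from 0 and 1, going around the circle does not help; as the bounds
    are closed, one extreme case survives. *)
Lemma cnear_real x y e : 0 <= x -> x < 1 -> e <= y -> y <= 1 - e ->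
  cnear x y e -> `|x - y| <= e \/ (x = 0 /\ y = 1 - e).
Proof.
move=> x0 x1 ey ye [z hz].
have [z1|z1|z0] := ltgtP z 0.
- have : (z%:~R : R) <= -1 by rewrite (_ : -1 = (-1)%:~R) ?ler_int ?mulrNz //; lia.
  move: hz; rewrite ler_norml => /andP[h1 h2] h3; right; split; lra.
- have : 1 <= (z%:~R : R) by rewrite ler1z; lia.
  move: hz; rewrite ler_norml => /andP[h1 h2] h3; lra.
- by left; rewrite z0 subr0 in hz.
Qed.

Lemma rotationP (a x : R) : exists z : int, rotation a x = x + a + z%:~R.
Proof. by exists (- Num.floor (x + a)); rewrite /rotation mulrNz. Qed.

Lemma rotation_ge0 (a x : R) : 0 <= rotation a x.
Proof. by rewrite /rotation subr_ge0 floor_le. Qed.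

Lemma rotation_lt1 (a x : R) : rotation a x < 1.
Proof. by rewrite /rotation; have := floorD1_gt (x + a); rewrite intrD; lra. Qed.

Lemma circle_uniq x y (z : int) : 0 <= x -> x < 1 -> 0 <= y -> y < 1 ->
  x = y + z%:~R -> x = y.
Proof.
move=> x0 x1 y0 y1 xy; suff z0 : z = 0 by rewrite xy z0 addr0.
have : (z%:~R : R) < 1%:~R by lra.
have : ((-1)%:~R : R) < z%:~R by rewrite mulrNz; lra.
rewrite !ltr_int; lia.
Qed.

Lemma rotation_uniq (a x y : R) (z : int) : 0 <= y -> y < 1 ->
  y = x + a + z%:~R -> rotation a x = y.
Proof.
move=> y0 y1 yE; have [w hw] := rotationP a x.
apply: (@circle_uniq _ _ (w - z)); rewrite ?rotation_ge0 ?rotation_lt1 //.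
by rewrite hw yE intrD mulrNz; ring.
Qed.

Lemma rotationD (a b x : R) : rotation b (rotation a x) = rotation (a + b) x.
Proof.
have [w hw] := rotationP a x; have [z hz] := rotationP b (rotation a x).
apply/esym/(@rotation_uniq _ _ _ (w + z)); rewrite ?rotation_ge0 ?rotation_lt1 //.
by rewrite hz hw intrD; ring.
Qed.

Lemma rotation0 x : 0 <= x -> x < 1 -> rotation 0 x = x.
Proof. by move=> x0 x1; apply: (@rotation_uniq _ _ _ 0) => //; rewrite !addr0. Qed.

Lemma cnear_rotation (a x : R) : cnear (rotation a x) (x + a) 0.
Proof. by have [z hz] := rotationP a x; apply: (@cnear_int _ _ z). Qed.

Lemma cnear_eq x y : 0 <= x -> x < 1 -> 0 <= y -> y < 1 ->
  (forall e, 0 < e -> cnear x y e) -> x = y.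
Proof.
move=> x0 x1 y0 y1 near.
have [xy|yx|//] := ltgtP x y; exfalso.
- pose e := Num.min ((y - x) / 2) ((1 - (y - x)) / 2).
  have e0 : 0 < e by rewrite lt_min; apply/andP; split; lra.
  have [z] := near e e0; rewrite ler_norml => /andP[h1 h2].
  have e1 : e <= (y - x) / 2 by rewrite ge_min lexx.
  have e2 : e <= (1 - (y - x)) / 2 by rewrite ge_min lexx orbT.
  have : (z%:~R : R) < 0%:~R by rewrite mulr0z; lra.
  have : ((-1)%:~R : R) < z%:~R by rewrite mulrNz; lra.
  by rewrite !ltr_int; lia.
- pose e := Num.min ((x - y) / 2) ((1 - (x - y)) / 2).
  have e0 : 0 < e by rewrite lt_min; apply/andP; split; lra.
  have [z] := near e e0; rewrite ler_norml => /andP[h1 h2].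
  have e1 : e <= (x - y) / 2 by rewrite ge_min lexx.
  have e2 : e <= (1 - (x - y)) / 2 by rewrite ge_min lexx orbT.
  have : (0%:~R : R) < z%:~R by rewrite mulr0z; lra.
  have : (z%:~R : R) < 1%:~R by lra.
  by rewrite !ltr_int; lia.
Qed.

End CircleDistance.

Lemma truncn_divn (R : realType) (x : R) (c : nat) : 0 <= x -> (0 < c)%N ->
  (Num.truncn (c%:R * x) %/ c)%N = Num.truncn x.
Proof.
move=> x0 c0; apply/esym/truncn_def.
have cR : 0 < (c%:R : R) by rewrite ltr0n.
have /truncn_itv/andP[h1 h2] : 0 <= c%:R * x by rewrite mulr_ge0 ?ler0n.
set t := Num.truncn (c%:R * x) in h1 h2 *; apply/andP; split.
- rewrite -(ler_pM2l cR) -natrM (le_trans _ h1) // ler_nat mulnC; exact: leq_trunc_div.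
- rewrite -(ltr_pM2l cR) -natrM (lt_le_trans h2) // ler_nat mulnC; exact: ltn_ceil.
Qed.

Lemma modn_intP (q m n : nat) (w : int) : m%:Z = n%:Z + w * q%:Z -> m = n %[mod q].
Proof.
move=> h; apply/eqP; rewrite -eqz_nat -!modz_nat h addrC modzMDl //.
Qed.

Lemma modn_int_ex (q m n : nat) : m = n %[mod q] -> exists w : int, m%:Z = n%:Z + w * q%:Z.
Proof.
move=> h; exists ((m %/ q)%N%:Z - (n %/ q)%N%:Z).
rewrite {1}(divn_eq m q) {1}(divn_eq n q) h; lia.
Qed.

(** * Measurability *)

Section MeasurablePredicates.
Context (d : measure_display) (T : measurableType d).
Implicit Types A B : set T.

Lemma measurable_ex (I : countType) (A : I -> set T) :
  (forall i, measurable (A i)) -> measurable [set x | exists i, A i x].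
Proof.
move=> mA; rewrite [X in measurable X](_ : _ = \bigcup_i A i).
  by apply: countable_bigcupT_measurable => //; exact: countableP.
by apply/seteqP; split=> x /=; [move=> [i Ai]; exists i|move=> [i _ Ai]; exists i].
Qed.

Lemma measurable_compl A : measurable A -> measurable [set x | ~ A x].
Proof. exact: measurableC. Qed.

Lemma measurable_all (I : countType) (A : I -> set T) :
  (forall i, measurable (A i)) -> measurable [set x | forall i, A i x].
Proof.
move=> mA; rewrite [X in measurable X](_ : _ = ~` [set x | exists i, (~` A i) x]).
  by apply/measurableC/measurable_ex => i; apply: measurableC.
by apply/seteqP; split=> x /=; [move=> h [i]; apply|move=> h i; apply: contrapT => ?; apply: h; exists i].
Qed.

Lemma measurable_conj A B : measurable A -> measurable B -> measurable [set x | A x /\ B x].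
Proof. exact: measurableI. Qed.

Lemma measurable_disj A B : measurable A -> measurable B -> measurable [set x | A x \/ B x].
Proof. exact: measurableU. Qed.

Lemma measurable_prop (P : Prop) : measurable [set x : T | P].
Proof.
have [p|np] := pselect P.
  by rewrite [X in measurable X](_ : _ = setT) //; apply/seteqP; split.
by rewrite [X in measurable X](_ : _ = set0) //; apply/seteqP; split.
Qed.

Lemma measurable_imp (P : Prop) A : (P -> measurable A) -> measurable [set x | P -> A x].
Proof.
move=> mA; have [p|np] := pselect P.
  rewrite [X in measurable X](_ : _ = A); first exact: mA.
  by apply/seteqP; split=> x /=; [apply|].
by rewrite [X in measurable X](_ : _ = setT) //; apply/seteqP; split=> // x _ /np.
Qed.

End MeasurablePredicates.

Lemma measurable_letter (i : int) (c : sym) : measurable [set x : symZ | x i = c].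
Proof. by apply: sub_sigma_algebra; exists i, c. Qed.

Definition shiftz (b : int) (x : bisequence) : bisequence := fun a => x (a + b).

Lemma shiftz0 x : shiftz 0 x = x.
Proof. by apply: funext => a; rewrite /shiftz addr0. Qed.

Lemma measurable_shiftz b : measurable_fun setT (shiftz b : symZ -> symZ).
Proof.
apply: (@measurability _ _ symZ symZ setT (shiftz b) cylinders) => //.
move=> _ [_ [i [c ->]] <-]; rewrite setTI; exact: measurable_letter (i + b) c.
Qed.

Section RealMeasurability.
Variable R : realType.
Implicit Types x a c : R.

(** Arcs are indexed by [Num.truncn (c * x)], so this covers every condition on the arc that
    contains a point. *)
Lemma measurable_truncn_mul c (P : set nat) :
  measurable [set x : R | P (Num.truncn (c * x))].
Proof.
have mle n : measurable [set x : R | (Num.truncn (c * x) <= n)%N].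
  rewrite [X in measurable X](_ : _ = ( *%R c) @^-1` `]-oo, n.+1%:R[%classic); last first.
    by apply/seteqP; split=> x /=; rewrite in_itv /= truncn_le_nat.
  by rewrite -[X in measurable X]setTI; apply: measurable_funM.
have meq n : measurable [set x : R | Num.truncn (c * x) = n].
  rewrite [X in measurable X](_ : _ = [set x : R | (Num.truncn (c * x) <= n)%N /\
     ~ ((0 < n)%N /\ (Num.truncn (c * x) <= n.-1)%N)]).
    apply: measurable_conj; first exact: mle.
    by apply: measurable_compl; apply: measurable_conj; [exact: measurable_prop|exact: mle].
  by apply/seteqP; split=> x /= h; clear -h; lia.
rewrite [X in measurable X](_ : _ = [set x : R | exists n, P n /\ Num.truncn (c * x) = n]).
  by apply: measurable_ex => n; apply: measurable_conj; [exact: measurable_prop|exact: meq].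
by apply/seteqP; split=> x /=; [move=> h; exists (Num.truncn (c * x))|move=> [n [h ->]]].
Qed.

Lemma measurable_rotation a : measurable_fun setT (rotation a : R -> R).
Proof.
move=> _ B mB; rewrite setTI.
rewrite (_ : _ @^-1` _ = [set x | exists z : int, (z%:~R <= x + a /\ x + a < z%:~R + 1) /\
   B (x + a - z%:~R)]).
  apply: measurable_ex => z; apply: measurable_conj; [apply: measurable_conj|].
  - rewrite [X in measurable X](_ : _ = (fun x => x + a) @^-1` `[z%:~R, +oo[%classic); last first.
      by apply/seteqP; split=> x /=; rewrite in_itv /= andbT.
    by rewrite -[X in measurable X]setTI; apply: measurable_funD.
  - rewrite [X in measurable X](_ : _ = (fun x => x + a) @^-1` `]-oo, z%:~R + 1[%classic); last first.
      by apply/seteqP; split=> x /=; rewrite in_itv.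
    by rewrite -[X in measurable X]setTI; apply: measurable_funD.
  - rewrite [X in measurable X](_ : _ = (fun x => x + a - z%:~R) @^-1` B) //.
    by rewrite -[X in measurable X]setTI; apply: measurable_funB => //; apply: measurable_funD.
apply/seteqP; split=> x /=.
  move=> h; exists (Num.floor (x + a)); split=> //; split; first exact: floor_le.
  by have := floorD1_gt (x + a); rewrite intrD.
move=> [z [[z1 z2] h]]; rewrite /rotation (_ : Num.floor _ = z) //.
by apply: floor_def; rewrite z1 intrD.
Qed.

Lemma measurable_unit_interval : measurable (@unit_interval R).
Proof.
rewrite (_ : unit_interval = `[0, 1[%classic) //.
by apply/seteqP; split=> x /=; rewrite in_itv /=; [move=> [-> ->]|move/andP].
Qed.

End RealMeasurability.

Definition okz (x : bisequence) (i : int) := okp (x i) (x (i + 1)).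

(** * Lebesgue measure on the circle *)

Definition image_measure (d d' : measure_display) (T1 : measurableType d) (T2 : measurableType d')
  (R : realType) (m : {measure set T1 -> \bar R}) (f : T1 -> T2)
  (mf : measurable_fun setT f) : {measure set T2 -> \bar R} :=
  measure_function_pushforward__canonical__measure_function_Measure m mf.

Lemma image_measureE (d d' : measure_display) (T1 : measurableType d) (T2 : measurableType d')
  (R : realType) (m : {measure set T1 -> \bar R}) (f : T1 -> T2)
  (mf : measurable_fun setT f) A : image_measure m mf A = m (f @^-1` A).
Proof. by []. Qed.

Section FullMeasure.
Context (d : measure_display) (T : measurableType d) (R : realType).
Variable mu : {measure set T -> \bar R}.
Hypothesis mu1 : mu setT = 1%E.

Lemma mu_fin A : measurable A -> mu A \is a fin_num.
Proof.
move=> mA; rewrite ge0_fin_numE // (@le_lt_trans _ _ 1%E) ?ltry // -mu1.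
by apply: le_measure; rewrite ?inE.
Qed.

Lemma mu_setC A : measurable A -> mu (~` A) = (1 - mu A)%E.
Proof.
move=> mA; have lt : (mu setT < +oo)%E by rewrite mu1 ltry.
by rewrite -setTD measureD ?setTI //; congr (_ - _)%E; exact: mu1.
Qed.

Lemma mu_null_compl A : measurable A -> mu A = 1%E -> mu (~` A) = 0%E.
Proof. by move=> mA A1; rewrite mu_setC // A1 subee. Qed.

Lemma mu_full A B : measurable A -> measurable B -> mu (~` A) = 0%E -> mu (B `&` A) = mu B.
Proof.
move=> mA mB A0; have e : mu B = (mu (B `\` A) + mu (B `&` A))%E := measureDI mu mB mA.
rewrite e.
rewrite (_ : mu (B `\` A) = 0%E) ?add0e //.
apply/eqP; rewrite eq_le measure_ge0 andbT -A0.
by apply: le_measure; rewrite ?inE; [exact: measurableD|exact: measurableC|move=> x []].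
Qed.

End FullMeasure.

Section CircleMeasure.
Variable R : realType.
Notation U := (@unit_interval R).
Local Notation mR := (measurableTypeR R).

(** Convertible to [lebesgue_circle], but packaged as a measure. *)
Definition circle_measure : {measure set mR -> \bar R} :=
  mrestr lebesgue_measure (@measurable_unit_interval R).

Lemma circle_measureE A : circle_measure A = lebesgue_measure (A `&` U).
Proof. by []. Qed.

Lemma unit_intervalE : U = `[0, 1[%classic.
Proof.
by apply/seteqP; split=> x /=; rewrite in_itv /=; [move=> [-> ->]|move/andP].
Qed.

Lemma itvcoI1 (x : R) : `[x, +oo[%classic `&` U = `[Num.max x 0, 1[%classic.
Proof.
apply/seteqP; split=> y /=; rewrite !in_itv /= ?andbT ge_max.
  by move=> [xy [y0 y1]]; apply/andP; split=> //; apply/andP.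
by move=> /andP[/andP[xy y0] y1].
Qed.

Lemma circle_measure_itv (u v : R) : 0 <= u -> u <= v -> v <= 1 ->
  circle_measure `[u, v[%classic = (v - u)%:E.
Proof.
move=> u0 uv v1; rewrite circle_measureE (_ : _ `&` _ = `[u, v[%classic).
  rewrite lebesgue_measure_itv /= lte_fin; case: ltP => [_|vu]; first by rewrite EFinB.
  by have -> : v = u; [apply/eqP; rewrite eq_le vu|rewrite subrr].
apply/seteqP; split=> y /=; rewrite !in_itv /=; first by case.
by move=> /andP[uy yv]; rewrite uy yv; split=> //; split; lra.
Qed.

Lemma circle_measure_ext A B : A `&` U = B `&` U -> circle_measure A = circle_measure B.
Proof. by rewrite !circle_measureE => ->. Qed.

Lemma circle_measure_setT : circle_measure setT = 1%E.
Proof.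
rewrite circle_measureE setTI unit_intervalE lebesgue_measure_itv /= lte_fin ltr01.
by rewrite -EFinB subr0.
Qed.

Lemma circle_measure_unit : circle_measure U = 1%E.
Proof. by rewrite circle_measureE setIid -[U]setTI -circle_measureE circle_measure_setT. Qed.

Lemma negligible_unitC : circle_measure.-negligible (~` U).
Proof.
have mU := @measurable_unit_interval R.
apply/negligibleP; first exact: measurableC.
apply: mu_null_compl => //; [exact: circle_measure_setT|exact: circle_measure_unit].
Qed.

(** Right rays form a generator stable under intersection; for a measure carried by [U] a ray counts
    as [[Num.max x 0, 1[]. *)
Lemma circle_measure_unique (m : {measure set mR -> \bar R}) :
  m setT = 1%E -> m U = 1%E -> (forall x, 0 <= x <= 1 -> m `[x, 1[%classic = (1 - x)%:E) ->
  forall A, measurable A -> m A = circle_measure A.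
Proof.
move=> mT mU mi A mA; have mmU := @measurable_unit_interval R.
refine (@measure_unique _ _ mR (@RGenCInfty.G R) (fun n => `[- n%:R, +oo[%classic) _ _ _ _ m circle_measure _ _ A mA).
- exact: RGenCInfty.measurableE.
- move=> _ _ [x ->] [y ->]; exists (Num.max x y); apply/seteqP; split=> z /=;
    rewrite !in_itv /= !andbT ge_max; [by move=> [-> ->]|by move/andP].
- by move=> n; exists (- n%:R).
- apply/seteqP; split=> // x _; exists (Num.truncn (- x)).+1 => //=.
  by rewrite in_itv /= andbT lerNl; apply/ltW/truncnS_gt.
- move=> _ [x ->]; rewrite -(mu_full mmU _ (mu_null_compl mT mmU mU)) //.
  rewrite circle_measureE itvcoI1 -[in RHS](setIid `[_, _[%classic).
  have m0 : 0 <= Num.max x 0 by rewrite le_max lexx orbT.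
  have [m1|m1] := leP (Num.max x 0) 1.
    rewrite mi ?m0 // setIid lebesgue_measure_itv /= lte_fin; case: ltP => h.
      by rewrite EFinB.
    by have -> : Num.max x 0 = 1; [apply/eqP; rewrite eq_le m1|rewrite subrr].
  by rewrite setIid set_itv_ge ?bnd_simp -?leNgt ?(ltW m1) // !measure0.
- by move=> n; rewrite (@le_lt_trans _ _ 1%E) ?ltry // -mT le_measure ?inE.
Qed.

Lemma circle_measure_rotation (a : R) A : measurable A ->
  circle_measure (rotation a @^-1` A) = circle_measure A.
Proof.
move=> mA; have [z cE] := rotationP 0 a; set c := rotation 0 a in cE.
have c0 : 0 <= c by apply: rotation_ge0.
have c1 : c < 1 by apply: rotation_lt1.
have rc x : rotation a x = rotation c x.
  have [w hw] := rotationP c x.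
  apply: (@rotation_uniq _ _ _ _ (w + z)); rewrite ?rotation_ge0 ?rotation_lt1 //.
  by rewrite hw cE addr0 intrD; ring.
have rlt x : 0 <= x -> x + c < 1 -> rotation a x = x + c.
  move=> x0 xc; rewrite rc; apply: (@rotation_uniq _ _ _ _ 0); rewrite ?addr0 //.
  by rewrite addr_ge0.
have rge x : x < 1 -> 1 <= x + c -> rotation a x = x + c - 1.
  move=> x1 xc; rewrite rc; apply: (@rotation_uniq _ _ _ _ (-1)); rewrite ?mulrNz //; lra.
have mrot : measurable_fun (setT : set mR) (rotation a : mR -> mR) := @measurable_rotation R a.
apply: (@circle_measure_unique (image_measure circle_measure mrot)) => //.
- by rewrite image_measureE preimage_setT circle_measure_setT.
- rewrite image_measureE (_ : _ @^-1` _ = setT) ?circle_measure_setT //.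
  by apply/seteqP; split=> // x _; split; [exact: rotation_ge0|exact: rotation_lt1].
move=> x /andP[x0 x1]; rewrite image_measureE.
(* Rotated back by [c], the interval [[x, 1[] stays in one piece if [c <= x]; otherwise it wraps
   around 0 into two. *)
have [cx|xc] := leP c x.
  rewrite (@circle_measure_ext _ `[x - c, 1 - c[%classic).
    by rewrite circle_measure_itv; [congr EFin; ring| | |]; lra.
  apply/seteqP; split=> y /= [h [y0 y1]]; split=> //=; move: h; rewrite !in_itv /=.
    have [yc|yc] := ltP (y + c) 1.
      by rewrite rlt // => /andP[h1 h2]; apply/andP; split; lra.
    by rewrite rge // => /andP[h1 h2]; lra.
  by move=> /andP[h1 h2]; rewrite rlt //; [apply/andP; split|]; lra.
rewrite (@circle_measure_ext _ (`[0, 1 - c[%classic `|` `[1 - c + x, 1[%classic)).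
  rewrite measureU //; last first.
    apply/seteqP; split=> // y /=; rewrite !in_itv /= => -[/andP[h1 h2] /andP[h3 h4]]; lra.
  transitivity (((1 - c) - 0)%:E + (1 - (1 - c + x))%:E)%E; last by rewrite -EFinD; congr EFin; ring.
  by congr (_ + _)%E; apply: circle_measure_itv; lra.
apply/seteqP; split=> y /= [h [y0 y1]]; split=> //=; move: h; rewrite !in_itv /=.
  have [yc|yc] := ltP (y + c) 1; first by move=> _; left; apply/andP; split; lra.
  by rewrite rge // => /andP[h1 h2]; right; apply/andP; split; lra.
case=> /andP[h1 h2].
  by rewrite rlt //; [apply/andP; split|]; lra.
by rewrite rge //; [apply/andP; split|]; lra.
Qed.

Lemma circle_measure_itv_le (u v : R) : u <= v ->
  (circle_measure `[u, v[%classic <= (v - u)%:E)%E.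
Proof.
move=> uv; rewrite circle_measureE.
apply: (@le_trans _ _ (lebesgue_measure (`[u, v[%classic : set mR))).
  apply: le_measure; rewrite ?inE.
  - by apply: measurableI; [exact: measurable_itv|exact: measurable_unit_interval].
  - exact: measurable_itv.
  - exact: subIsetl.
rewrite lebesgue_measure_itv /= lte_fin; case: ltP => _; first by rewrite EFinB.
by rewrite lee_fin subr_ge0.
Qed.

End CircleMeasure.

Section Intervals.
Variable R : realType.
Implicit Types a b c : R.

Lemma itvco_disj a b c : `[a, b[%classic `&` `[b, c[%classic = set0 :> set R.
Proof.
apply/seteqP; split=> // y /=; rewrite !in_itv /= => -[/andP[_ yb] /andP[yb' _]].
by move: (lt_le_trans yb yb'); rewrite ltxx.
Qed.

Lemma itvco_split a b c : a <= b -> b <= c ->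
  `[a, c[%classic = `[a, b[%classic `|` `[b, c[%classic :> set R.
Proof.
move=> ab bc; apply/seteqP; split=> y /=; rewrite !in_itv /=.
  by move=> /andP[-> ->]; rewrite andbT; case: (ltP y b); [left|right].
by case=> /andP[h1 h2]; apply/andP; split; lra.
Qed.

End Intervals.

Lemma nneseries_term_small (R : realType) (u : nat -> R) : (forall n, 0 <= u n) ->
  (\sum_(0 <= n <oo) (u n)%:E < +oo)%E ->
  forall e, 0 < e -> exists n0, forall n, (n0 <= n)%N -> u n <= e.
Proof.
move=> u0 us e e0.
have up n : true -> (0 <= (u n)%:E)%E by rewrite lee_fin.
have /fine_cvgP[[n1 _ h1] /cvgrPdist_lt /(_ e e0)[n2 _ h2]] := nneseries_tail_cvg us up.
exists (maxn n1 n2) => n; rewrite geq_max => /andP[nn1 nn2].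
have := h1 n nn1; have := h2 n nn2; rewrite /= sub0r normrN.
have := @nneseries_lim_ge _ (fun n => (u n)%:E) xpredT n n.+1 (fun i _ => up i).
rewrite big_nat1; move: (\big[_/_]_(_ <= _ <oo) _) => [r| |] //=.
rewrite lee_fin => ur /ltW nr _; apply: le_trans ur _.
exact: le_trans (ler_norm _) nr.
Qed.

(** * One-sided tails *)

Section Tails.
Variable R : realType.

Lemma measurable_symZ1 (x : symZ) : measurable [set x].
Proof.
rewrite [X in measurable X](_ : _ = [set y : symZ | forall i : int, y i = x i]).
  by apply: measurable_all => i; exact: measurable_letter.
by apply/seteqP; split=> y /=; [move=> ->|move=> h; apply: funext].
Qed.

Definition left_tail (b : int) : set symZ := [set x | forall i : int, i < b -> okz x i].
Definition right_tail (b : int) : set symZ := [set x | forall i : int, b <= i -> okz x i].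

Lemma measurable_okz i : measurable [set x : symZ | okz x i].
Proof.
rewrite [X in measurable X](_ : _ = [set x : symZ | exists c c' : sym,
    okp c c' /\ (x i = c /\ x (i + 1) = c')]).
  apply: measurable_ex => c; apply: measurable_ex => c'.
  apply: measurable_conj; first exact: measurable_prop.
  by apply: measurable_conj; exact: measurable_letter.
apply/seteqP; split=> x /=; first by move=> h; exists (x i), (x (i + 1)).
by move=> [c [c' [h [e1 e2]]]]; rewrite /okz e1 e2.
Qed.

Lemma measurable_left_tail b : measurable (left_tail b).
Proof. by apply: measurable_all => i; apply: measurable_imp => _; exact: measurable_okz. Qed.

Lemma measurable_right_tail b : measurable (right_tail b).
Proof. by apply: measurable_all => i; apply: measurable_imp => _; exact: measurable_okz. Qed.

(** The parameters form a countable type, so a nonatomic measure ignores all these sequences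
    together. *)
Definition step_seq (o : option int) (c : sym) : symZ :=
  if o is Some b then fun i => if i < b then Esym else Bsym else fun=> c.

Lemma all_okz (x : symZ) : (forall i, okz x i) -> exists o c, x = step_seq o c.
Proof.
move=> ok; have okS i : x i = Bsym -> x (i + 1) = Bsym.
  by have := ok i; rewrite /okz; case: (x i) => //; case: (x (i + 1)).
have two i : x i <> Bsym -> x i = Esym.
  by have := ok i; rewrite /okz; case: (x i).
have up i (n : nat) : x i = Bsym -> x (i + n%:Z) = Bsym.
  move=> xi; elim: n => [|n IH]; first by rewrite addr0.
  by rewrite -addn1 PoszD addrA okS.
have [[i1 x1]|nE] := pselect (exists i, x i = Esym); last first.
  exists None, Bsym; apply: funext => i /=; apply: contrapT => /two h.
  by apply: nE; exists i.
have [[i0 x0]|nB] := pselect (exists i, x i = Bsym); last first.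
  exists None, Esym; apply: funext => i /=; apply: two => h.
  by apply: nB; exists i.
have i10 : (i1 < i0)%R.
  rewrite ltNge; apply/negP => h; have := up i0 (absz (i1 - i0)) x0.
  by rewrite gez0_abs ?subr_ge0 // [_ + (_ - _)]addrC subrK x1.
have ex : exists n : nat, x (i1 + n%:Z) == Bsym.
  exists (absz (i0 - i1)); rewrite gez0_abs; last by rewrite subr_ge0 ltW.
  by rewrite [_ + (_ - _)]addrC subrK x0.
case: (ex_minnP ex) => n /eqP xn min.
exists (Some (i1 + n%:Z)), Bsym; apply: funext => i /=; case: ltP => h.
  apply: two => xi; have [ii|ii] := ltP i i1.
    have := up i (absz (i1 - i)) xi.
    by rewrite gez0_abs ?subr_ge0 ?(ltW ii) // [_ + (_ - _)]addrC subrK x1.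
  have := min (absz (i - i1)); rewrite gez0_abs ?subr_ge0 // [_ + (_ - _)]addrC subrK xi eqxx.
  by move=> /(_ isT); clear -h ii; lia.
by have := up _ (absz (i - (i1 + n%:Z))%R) xn; rewrite gez0_abs ?subr_ge0 // [_ + (_ - _)]addrC subrK.
Qed.

Variable nu : {measure set symZ -> \bar R}.
Hypothesis nu1 : nu setT = 1%E.
Hypothesis nu_inv : forall A : set symZ, measurable A -> nu (sh @^-1` A) = nu A.
Hypothesis nu_atomless : forall x : symZ, nu [set x] = 0%E.

Lemma all_okz_null (A : set symZ) : measurable A -> (forall x, A x -> forall i, okz x i) ->
  nu A = 0%E.
Proof.
move=> mA h; apply/(@negligibleP _ _ _ nu) => //.
pose F n : set symZ := if unpickle n is Some oc then [set step_seq oc.1 oc.2] else set0.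
apply: (@negligibleS _ _ _ _ (\bigcup_n F n)).
  move=> x /h /all_okz[s [c xE]]; exists (pickle (s, c)) => //.
  by rewrite /F pickleK.
apply: negligible_bigcup => n; rewrite /F; case: unpickle => [oc|]; last exact: negligible_set0.
apply/negligibleP; [exact: measurable_symZ1|exact: nu_atomless].
Qed.

Lemma tail_null (F : nat -> set symZ) : (forall n, measurable (F n)) ->
  (forall n, F n.+1 `<=` F n) -> (forall n, nu (F n.+1) = nu (F n)) ->
  (forall x, (forall n, F n x) -> forall i, okz x i) -> nu (F 0%N) = 0%E.
Proof.
move=> mF dF cF okF; have c n : nu (F n) = nu (F 0%N) by elim: n => // n <-.
have mI : measurable (\bigcap_n F n) by exact: bigcapT_measurable.
have lt : (nu (F 0%N) < +oo)%E.
  by rewrite -ge0_fin_numE //; exact: mu_fin.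
have hF : {homo F : n m / (n <= m)%N >-> (m <= n)%O}.
  by apply/nonincreasing_seqP => n; apply/subsetPset.
have cv := nonincreasing_cvg_mu lt mF mI hF.
have cv' : (nu \o F) n @[n --> \oo] --> nu (F 0%N).
  by rewrite (_ : nu \o F = fun=> nu (F 0%N)); [exact: cvg_cst|apply: funext => n; exact: c].
rewrite (cvg_unique (@ereal_hausdorff R) cv' cv).
by apply: all_okz_null => // x Fx; apply: okF => n; apply: Fx.
Qed.

Lemma sh_left_tail b : sh @^-1` left_tail b = left_tail (b + 1).
Proof.
apply/seteqP; split=> x /= h i ib.
  by have := h (i - 1); rewrite /okz /sh subrK; apply; rewrite ltrBlDr.
by have := h (i + 1); rewrite /okz /sh; apply; rewrite ltrD2r.
Qed.

Lemma sh_right_tail b : sh @^-1` right_tail b = right_tail (b + 1).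
Proof.
apply/seteqP; split=> x /= h i ib.
  by have := h (i - 1); rewrite /okz /sh subrK; apply; rewrite lerBrDr.
by have := h (i + 1); rewrite /okz /sh; apply; rewrite lerD2r.
Qed.

Lemma nu_left_tail b : nu (left_tail b) = 0%E.
Proof.
rewrite -[b]addr0; apply: (@tail_null (fun n => left_tail (b + n%:Z))).
- by move=> n; exact: measurable_left_tail.
- by move=> n x h i ib; apply: h; clear -ib; lia.
- move=> n; rewrite -addn1 PoszD addrA -sh_left_tail; apply: nu_inv.
  exact: measurable_left_tail.
- by move=> x h i; apply: (h (absz (i - b)).+1); clear; lia.
Qed.

Lemma nu_right_tail b : nu (right_tail b) = 0%E.
Proof.
rewrite -[b]subr0; apply: (@tail_null (fun n => right_tail (b - n%:Z))).
- by move=> n; exact: measurable_right_tail.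
- by move=> n x h i ib; apply: h; clear -ib; lia.
- move=> n; rewrite -(nu_inv (measurable_right_tail _)) sh_right_tail.
  by congr (nu (right_tail _)); clear; lia.
- by move=> x h i; apply: (h (absz (i - b)).+1); clear; lia.
Qed.

End Tails.

(** * Structure of the words *)

Section CircleFactor.
Variables k l : nat -> nat.
Hypothesis k2 : forall n, (2 <= k n)%N.
Hypothesis l0 : forall n, (0 < l n)%N.

Notation p := (coef_p k l).
Notation q := (coef_q k l).
Notation W n := (nth Bsym (circ_word k l n)).
Notation J n := (circ_j (p n) (q n)).

Lemma coef_pS n : p n.+1 = (p n * q n * k n * l n + 1)%N.
Proof. by rewrite /coef_p /coef_q /=; case: coef_pq. Qed.

Lemma coef_qS n : q n.+1 = (k n * l n * q n * q n)%N.
Proof. by rewrite /coef_p /coef_q /=; case: coef_pq => a b /=; rewrite mulnA. Qed.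

Lemma coef_q_gt0 n : (0 < q n)%N.
Proof.
elim: n => // n IH; rewrite coef_qS !muln_gt0 IH l0 !andbT.
exact: leq_trans (k2 n).
Qed.

Lemma leq_coef_qS n : (2 * q n * q n <= q n.+1)%N.
Proof.
rewrite coef_qS !leq_mul // -[2%N]muln1; exact: leq_mul (k2 n) (l0 n).
Qed.

Lemma ltn_coef_q n : (n < q n)%N.
Proof.
elim: n => // n IH; apply: leq_trans (leq_coef_qS n); nia.
Qed.

Lemma coef_q_homo : {homo q : m n / (m <= n)%N}.
Proof.
apply: homo_leq => // [x y z|n]; first exact: leq_trans.
apply: leq_trans (leq_coef_qS n); have := coef_q_gt0 n; nia.
Qed.

Lemma coef_coprime n : coprime (p n) (q n).
Proof.
case: n => // n; rewrite coef_pS coef_qS.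
have e : (p n * q n * k n * l n = p n * (k n * l n * q n))%N by lia.
have cop : coprime (p n * (k n * l n * q n) + 1) (k n * l n * q n).
  by rewrite coprime_sym /coprime gcdnMDl gcdn1.
by rewrite coprimeMr e cop /=; move: cop; rewrite coprimeMr => /andP[].
Qed.

Lemma J_lt n i : (J n i < q n)%N.
Proof. by have [] := circ_j_spec i (coef_q_gt0 n) (coef_coprime n). Qed.

Lemma J_eq n i : p n * J n i = i %[mod q n].
Proof. by have [] := circ_j_spec i (coef_q_gt0 n) (coef_coprime n). Qed.

Lemma J_uniq n i j : (j < q n)%N -> p n * j = i %[mod q n] -> J n i = j.
Proof. exact: circ_j_uniq (coef_q_gt0 n) (coef_coprime n). Qed.

Lemma J0 n : J n 0 = 0%N.
Proof. by apply: J_uniq (coef_q_gt0 n) _; rewrite muln0. Qed.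

(** All [k n] words under the operator are equal here, so a factor depends on the row [i] only. *)
Definition cell n i := nseq (q n - J n i) Bsym
   ++ flatten (nseq (l n - 1) (circ_word k l n)) ++ nseq (J n i) Esym.

Lemma circ_word_cells n : circ_word k l n.+1 =
  flatten [seq flatten [seq cell n i | j <- iota 0 (k n)] | i <- iota 0 (q n)].
Proof.
rewrite /= /circular; congr flatten; apply: eq_map => i; congr flatten.
apply/eq_in_map => j; rewrite mem_iota add0n => /andP[_ jk].
by rewrite /cell nth_nseq jk.
Qed.

Lemma size_circ_word n : size (circ_word k l n) = q n.
Proof.
elim: n => // n IH; rewrite circ_word_cells.
have sc i : size (cell n i) = (l n * q n)%N.
  rewrite /cell !size_cat !size_nseq size_flatten /shape map_nseq sumn_nseq IH.
  have := J_lt n i; have := l0 n; nia.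
rewrite (@size_flatten_const _ _ (k n * (l n * q n))%N) ?coef_qS; first by lia.
by move=> m _; rewrite (@size_flatten_const _ _ (l n * q n)%N).
Qed.

Lemma size_cell n i : size (cell n i) = (l n * q n)%N.
Proof.
rewrite /cell !size_cat !size_nseq size_flatten /shape map_nseq sumn_nseq.
rewrite size_circ_word; have := J_lt n i; have := l0 n; nia.
Qed.

Lemma nth_cell n i t : (t < l n * q n)%N -> nth Bsym (cell n i) t =
  if (t < q n - J n i)%N then Bsym
  else if (l n * q n - J n i <= t)%N then Esym else W n ((t + J n i) %% q n).
Proof.
move=> tl; rewrite /cell !nth_cat !size_nseq nth_nseq.
case: ltnP => // qt; rewrite size_flatten /shape map_nseq sumn_nseq size_circ_word.
have jq := J_lt n i; have lpos := l0 n.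
have lq : (l n * q n = q n * (l n - 1) + q n)%N.
  by rewrite -mulnSr subn1 prednK // mulnC.
rewrite nth_nseq; set r := (t - (q n - J n i))%N.
have -> : (r < q n * (l n - 1))%N = ~~ (l n * q n - J n i <= t)%N.
  by rewrite -ltnNge /r; lia.
case: (leqP (l n * q n - J n i) t) => lt /=; first by rewrite ifT // /r; lia.
have er : ((t + J n i) %% q n = r %% q n)%N.
  have -> : (t + J n i = r + q n)%N by rewrite /r; lia.
  by rewrite modnDr.
have rl : (r < (l n - 1) * q n)%N by rewrite /r [(_ * q n)%N]mulnC; lia.
rewrite er {1}(divn_eq r (q n)).
have e (T : Type) (x : T) m : nseq m x = [seq x | _ <- iota 0 m].
  by elim: m 0%N => //= m IH a; rewrite -(IH a.+1).
rewrite e (@nth_flatten_const _ _ (fun=> circ_word k l n) (q n)) //.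
- by move=> *; apply: size_circ_word.
- by rewrite ltn_divLR // coef_q_gt0.
- by rewrite ltn_pmod // coef_q_gt0.
Qed.

Lemma W_S n B t : (B < k n * q n)%N -> (t < l n * q n)%N ->
  W n.+1 (B * (l n * q n) + t) =
  if (t < q n - J n (B %/ k n))%N then Bsym
  else if (l n * q n - J n (B %/ k n) <= t)%N then Esym
  else W n ((t + J n (B %/ k n)) %% q n).
Proof.
move=> Bk tl; rewrite -nth_cell //.
have k0 : (0 < k n)%N by apply: leq_trans (k2 n).
rewrite circ_word_cells {1}(divn_eq B (k n)).
have -> : ((B %/ k n * k n + B %% k n) * (l n * q n) + t =
  B %/ k n * (k n * (l n * q n)) + (B %% k n * (l n * q n) + t))%N by lia.
have Bm : (B %% k n < k n)%N by rewrite ltn_pmod.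
rewrite (@nth_flatten_const _ _
  (fun i => flatten [seq cell n i | j <- iota 0 (k n)]) (k n * (l n * q n))%N).
- by rewrite (@nth_flatten_const _ _ (fun=> cell n (B %/ k n)) (l n * q n)%N) // => *; apply: size_cell.
- by move=> m _; rewrite (@size_flatten_const _ _ (l n * q n)%N) // => *; apply: size_cell.
- by rewrite ltn_divLR // mulnC.
- nia.
Qed.

Definition cell_off n s := (s %% (l n * q n))%N.
Definition cell_row n s := (s %/ (l n * q n) %/ k n)%N.

(** In a cell of row i the copies of w_n start after [q n - J n i] letters b, hence at offsets
    congruent to [- J n i] modulo [q n]; adding [J n i] aligns the numbering. *)
Definition descend n s := ((cell_off n s + J n (cell_row n s)) %% q n)%N.

Definition bdry n s := (cell_off n s < q n - J n (cell_row n s))%N ||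
  (l n * q n - J n (cell_row n s) <= cell_off n s)%N.

Lemma lq_gt0 n : (0 < l n * q n)%N.
Proof. by rewrite muln_gt0 l0 coef_q_gt0. Qed.

Lemma coef_qE n : q n.+1 = (k n * q n * (l n * q n))%N.
Proof. by rewrite coef_qS; lia. Qed.

Lemma cell_offE n B t : (t < l n * q n)%N -> cell_off n (B * (l n * q n) + t) = t.
Proof. by move=> tl; rewrite /cell_off modnMDl modn_small. Qed.

Lemma cell_rowE n B t : (t < l n * q n)%N ->
  cell_row n (B * (l n * q n) + t) = (B %/ k n)%N.
Proof.
by move=> tl; rewrite /cell_row divnMDl ?lq_gt0 // (divn_small tl) addn0.
Qed.

Lemma descend_lt n s : (descend n s < q n)%N.
Proof. by rewrite ltn_pmod // coef_q_gt0. Qed.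

Lemma cellP n s : (s < q n.+1)%N -> exists B t,
  [/\ (B < k n * q n)%N, (t < l n * q n)%N & s = (B * (l n * q n) + t)%N].
Proof.
move=> sq; exists (s %/ (l n * q n))%N, (s %% (l n * q n))%N; split.
- by rewrite ltn_divLR ?lq_gt0 // -coef_qE.
- by rewrite ltn_pmod // lq_gt0.
- exact: divn_eq.
Qed.

(** A cell holds [l n - 1] copies of w_n, hence the bound on the index [c] of the copy that contains
    [s]. *)
Lemma copyP n s : (s < q n.+1)%N -> ~~ bdry n s -> exists B c,
  [/\ (B < k n * q n)%N, (c.+1 < l n)%N &
      s = (B * (l n * q n) + (q n - J n (B %/ k n) + c * q n) + descend n s)%N].
Proof.
move=> /cellP[B [t [Bk tl ->]]].
rewrite /bdry /descend cell_offE // cell_rowE // negb_or -leqNgt -ltnNge.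
move=> /andP[qt tq]; have jq := J_lt n (B %/ k n); set j := J n _ in qt tq jq *.
set c := ((t - (q n - j)) %/ q n)%N; exists B, c.
have q0 := coef_q_gt0 n.
have e : (t = q n - j + c * q n + (t + j) %% q n)%N.
  rewrite -addnA; have -> : ((t + j) %% q n = (t - (q n - j)) %% q n)%N.
    by rewrite -[RHS]modnDr; congr modn; lia.
  by rewrite -divn_eq subnKC.
split=> //; last by rewrite -addnA -e.
have cq : (c.+1 * q n < l n * q n)%N by rewrite mulSn; lia.
by move: cq; rewrite ltn_mul2r q0.
Qed.

Lemma copy_pos n B c a (s := (B * (l n * q n) + (q n - J n (B %/ k n) + c * q n) + a)%N) :
  (B < k n * q n)%N -> (c.+1 < l n)%N -> (a < q n)%N ->
  [/\ (s < q n.+1)%N, ~~ bdry n s, descend n s = a & W n.+1 s = W n a].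
Proof.
move=> Bk cl aq; have jq := J_lt n (B %/ k n).
have clq : (c.+2 * q n <= l n * q n)%N by rewrite leq_mul2r cl orbT.
have tl : (q n - J n (B %/ k n) + c * q n + a < l n * q n)%N by move: clq; rewrite !mulSn; lia.
have sE : s = (B * (l n * q n) + (q n - J n (B %/ k n) + c * q n + a))%N.
  by rewrite /s -!addnA.
have pE : descend n s = a.
  rewrite /descend sE cell_offE // cell_rowE //.
  have -> : (q n - J n (B %/ k n) + c * q n + a + J n (B %/ k n) = c.+1 * q n + a)%N.
    by rewrite mulSn; lia.
  by rewrite modnMDl modn_small.
have t1 : (q n - J n (B %/ k n) + c * q n + a < q n - J n (B %/ k n))%N = false by lia.
have t2 : (l n * q n - J n (B %/ k n) <= q n - J n (B %/ k n) + c * q n + a)%N = false.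
  by move: clq; rewrite !mulSn; lia.
split=> //.
- by rewrite coef_qE sE; nia.
- by rewrite /bdry sE cell_offE // cell_rowE // t1 t2.
- rewrite sE W_S // t1 t2; congr nth.
  by have := pE; rewrite /descend sE cell_offE // cell_rowE.
Qed.

(* [lv m s n] is the position, inside the n-word around it, of the letter at
   position [s] of the m-word ([n <= m]); on boundary letters it continues the
   q_n-periodic numbering of the neighbouring n-words. *)
Fixpoint lv m s n := if m is m'.+1 then if (m' < n)%N then s else lv m' (descend m' s) n
  else s.

Lemma lv_id m s : lv m s m = s.
Proof. by case: m => //= m; rewrite ltnSn. Qed.

Lemma lv_S m s n : (n <= m)%N -> lv m.+1 s n = lv m (descend m s) n.
Proof. by move=> nm /=; rewrite ltnNge nm. Qed.

Lemma lv_lt m s n : (n <= m)%N -> (s < q m)%N -> (lv m s n < q n)%N.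
Proof.
elim: m s => [|m IH] s; first by rewrite leqn0 => /eqP ->.
rewrite leq_eqVlt => /orP[/eqP -> sq|nm sq]; first by rewrite lv_id.
by rewrite lv_S // IH // descend_lt.
Qed.

(** Without boundary letters in between, every descent stays in a genuine copy, so the whole n-word
    around [s] appears in w_m from [s - lv m s n] on. The level is [n'.+1] in the hypothesis because
    [bdry n'] speaks of positions of the word of level n' + 1. *)
Lemma lv_copy m s n : (n <= m)%N -> (s < q m)%N ->
  (forall n', (n <= n' < m)%N -> ~~ bdry n' (lv m s n'.+1)) ->
  (lv m s n <= s)%N /\ forall a, (a < q n)%N ->
   [/\ (s - lv m s n + a < q m)%N, W m (s - lv m s n + a) = W n a &
       lv m (s - lv m s n + a) n = a].
Proof.
elim: m s => [|m IH] s; first by rewrite leqn0 => /eqP -> s0 _; split=> // a a0; rewrite subnn.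
rewrite leq_eqVlt => /orP[/eqP -> sq _|nm sq nb].
  by rewrite lv_id; split=> // a aq; rewrite subnn lv_id.
have nbm : ~~ bdry m s by have := nb m; rewrite lv_id; apply; lia.
have [B [c [Bk cl sE]]] := copyP sq nbm.
have [|x y] := IH _ nm (descend_lt m s).
  move=> n' /andP[nn' n'm]; have := nb n'; rewrite lv_S //; apply; lia.
rewrite lv_S //; split; first by rewrite (leq_trans x) // [leqRHS]sE leq_addl.
move=> a aq; have [y1 y2 y3] := y a aq.
set r := (descend m s - lv m (descend m s) n + a)%N in y1 y2 y3.
have -> : (s - lv m (descend m s) n + a =
   B * (l m * q m) + (q m - J m (B %/ k m) + c * q m) + r)%N by rewrite /r {1}sE; lia.
have [z1 z2 z3 z4] := copy_pos Bk cl y1.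
by split=> //; rewrite ?z4 // lv_S // z3.
Qed.

Lemma lv_letter m s n : (n <= m)%N -> (s < q m)%N ->
  (forall n', (n <= n' < m)%N -> ~~ bdry n' (lv m s n'.+1)) ->
  W m s = W n (lv m s n).
Proof.
move=> nm sq nb; have [x /(_ (lv m s n) (lv_lt nm sq))[_ <- _]] := lv_copy nm sq nb.
by rewrite subnK.
Qed.

Lemma coef_p_ltn n : (p n < q n)%N.
Proof.
elim: n => // n IH; rewrite coef_pS coef_qS.
have : (0 < q n * k n * l n)%N.
  by rewrite !muln_gt0 coef_q_gt0 l0 (leq_trans _ (k2 n)).
have : (q n * k n * l n * (p n).+1 <= q n * k n * l n * q n)%N by rewrite leq_mul.
rewrite mulnS; set z := (q n * k n * l n)%N => H1 H0.
have -> : (p n * q n * k n * l n = z * p n)%N by rewrite /z; lia.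
have -> : (k n * l n * q n * q n = z * q n)%N by rewrite /z; lia.
suff : (1 < z)%N by lia.
by rewrite /z; have := k2 n; have := l0 n; have := coef_q_gt0 n; nia.
Qed.

Lemma coef_pS_gt n : (0 < p n)%N -> (2 * q n < p n.+1)%N.
Proof.
move=> p0; rewrite coef_pS addn1 ltnS.
have : (2 * (q n * 1) * 1 <= p n * q n * k n * l n)%N.
  have -> : (p n * q n * k n * l n = k n * (q n * p n) * l n)%N by lia.
  by rewrite !leq_mul.
by rewrite !muln1.
Qed.

Lemma coef_p_gt0 n : (0 < p n.+1)%N.
Proof. by rewrite coef_pS addn1. Qed.

Lemma coef_p_gt n : (2 <= n)%N -> (2 * q n.-1 < p n)%N.
Proof. by case: n => [|[|n]] // _; apply/coef_pS_gt/coef_p_gt0. Qed.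

Lemma coef_q_gt1 n : (0 < n)%N -> (1 < q n)%N.
Proof. by move=> n0; apply: leq_trans (ltn_coef_q n). Qed.

(* (p_n - 1)^2 is a multiple of q_n, hence p_n (p_n - 2) = -1 modulo q_n. *)
Lemma J_last n : (2 <= n)%N -> J n (q n).-1 = (p n - 2)%N.
Proof.
move=> n2; have pg := coef_p_gt n2; have pq := coef_p_ltn n.
have q0 := coef_q_gt0 n.-1; have q0' := coef_q_gt0 n.
apply: J_uniq; first by lia.
case: n n2 pg pq q0 q0' => [|n] // n2 pg pq q0 q0'.
apply/eqP; rewrite -(eqn_modDr 1) [((q n.+1).-1 + 1)%N]addn1 prednK // modnn -/(dvdn _ _).
have -> : (p n.+1 * (p n.+1 - 2) + 1 = (p n.+1 - 1) * (p n.+1 - 1))%N by lia.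
rewrite coef_pS addnK coef_qS; apply/dvdnP; exists (p n * p n * k n * l n)%N; lia.
Qed.

(** Modulo [q n], the gap multiplied by [p n] is i - (i + 1) = -1, so its residue is [J n (q n).-1],
    which is [p n - 2]; a number is at least its residue. *)
Lemma J_gap n i : (2 <= n)%N -> (i.+1 < q n)%N ->
  (p n - 2 <= J n i + q n - J n i.+1)%N.
Proof.
move=> n2 iq; have jq := J_lt n i.+1; have q0 := coef_q_gt0 n.
rewrite -J_last //; set d := (J n i + q n - J n i.+1)%N.
suff -> : J n (q n).-1 = (d %% q n)%N by exact: leq_mod.
apply: J_uniq; first by rewrite ltn_pmod.
rewrite modnMmr; apply/eqP; rewrite -(eqn_modDr (p n * J n i.+1)) -mulnDr /d subnK; last lia.
rewrite mulnDr addnC modnMDl.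
rewrite J_eq -[in eqbRHS]modnDmr J_eq modnDmr.
have -> : ((q n).-1 + i.+1 = i + q n)%N by lia.
by rewrite modnDr.
Qed.

Lemma W_first_part n B t : (B < k n * q n)%N -> (t < q n - J n (B %/ k n))%N ->
  W n.+1 (B * (l n * q n) + t) = Bsym.
Proof.
move=> Bk tq; rewrite W_S // ?tq //; have := l0 n; nia.
Qed.

Lemma W_last_part n B t : (B < k n * q n)%N -> (t < J n (B %/ k n))%N ->
  W n.+1 (B * (l n * q n) + (l n * q n - t.+1)) = Esym.
Proof.
move=> Bk tj; have jq := J_lt n (B %/ k n); have := lq_gt0 n => lq.
have ql : (q n <= l n * q n)%N by have := l0 n; nia.
rewrite W_S //; last by lia.
by rewrite ifF ?ifT //; lia.
Qed.

Lemma gap_okp n u c v : (forall a, (u <= a < c)%N -> W n a = Esym) ->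
  (forall a, (c <= a < v)%N -> W n a = Bsym) ->
  forall a, (u <= a)%N -> (a.+1 < v)%N -> okp (W n a) (W n a.+1).
Proof.
move=> he hb a ua av; case: (ltngtP a.+1 c) => ac.
- by rewrite !he //; lia.
- by rewrite !hb //; lia.
- by rewrite he ?hb //; lia.
Qed.

(** Boundary letters form blocks e..eb..b around the junctions of cells. As [p n - 2] is unbounded,
    a boundary letter of high level sits in a long stretch of admissible transitions. *)
Lemma bdry_run n s : (2 <= n)%N -> (s < q n.+1)%N -> bdry n s ->
  exists u v, [/\ (u <= s < v)%N, (v <= q n.+1)%N, (p n - 2 <= v - u)%N &
    forall a, (u <= a)%N -> (a.+1 < v)%N -> okp (W n.+1 a) (W n.+1 a.+1)].
Proof.
move=> n2 /cellP[B [t [Bk tl ->]]].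
rewrite /bdry cell_offE // cell_rowE //.
have k0 : (0 < k n)%N by apply: leq_trans (k2 n).
have lq := lq_gt0 n; have pq := coef_p_ltn n; have q0 := coef_q_gt0 n.
have ql : (q n <= l n * q n)%N by have := l0 n; nia.
have qE : q n.+1 = (k n * q n * (l n * q n))%N := coef_qE n.
have gap B' : (B'.+1 < k n * q n)%N ->
  exists u v, [/\ u = (B'.+1 * (l n * q n) - J n (B' %/ k n))%N,
    v = (B'.+1 * (l n * q n) + (q n - J n (B'.+1 %/ k n)))%N, (v <= q n.+1)%N, (p n - 2 <= v - u)%N &
    forall a, (u <= a)%N -> (a.+1 < v)%N -> okp (W n.+1 a) (W n.+1 a.+1)].
  move=> B'k; have j1 := J_lt n (B' %/ k n); have j2 := J_lt n (B'.+1 %/ k n).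
  exists (B'.+1 * (l n * q n) - J n (B' %/ k n))%N,
    (B'.+1 * (l n * q n) + (q n - J n (B'.+1 %/ k n)))%N; split=> //.
  - have : (B'.+2 * (l n * q n) <= q n.+1)%N by rewrite qE leq_mul.
    rewrite (mulSn B'.+1); lia.
  - have -> : (B'.+1 * (l n * q n) + (q n - J n (B'.+1 %/ k n)) -
        (B'.+1 * (l n * q n) - J n (B' %/ k n)) = J n (B' %/ k n) + q n - J n (B'.+1 %/ k n))%N.
      by rewrite mulSn; lia.
    have := divn_eq B' (k n); have := divn_eq B'.+1 (k n).
    have := ltn_pmod B' k0; have := ltn_pmod B'.+1 k0.
    set i := (B' %/ k n)%N; set i' := (B'.+1 %/ k n)%N => r1 r2 e1 e2.
    have iq : (i' < q n)%N by rewrite /i' ltn_divLR // mulnC.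
    (* Inside a row the block has length [q n]; between two rows [J_gap] applies. *)
    have [ii|ii] : i' = i \/ i' = i.+1 by nia.
      by rewrite ii; lia.
    by rewrite ii; apply: J_gap => //; rewrite -ii.
  - apply: (@gap_okp _ _ (B'.+1 * (l n * q n))%N) => a /andP[a1 a2].
      have -> : a = (B' * (l n * q n) + (l n * q n - (B'.+1 * (l n * q n) - a).-1.+1))%N.
        by rewrite mulSn in a1 a2 *; lia.
      by apply: W_last_part; lia.
    have -> : a = (B'.+1 * (l n * q n) + (a - B'.+1 * (l n * q n)))%N by lia.
    by apply: W_first_part => //; lia.
case/orP => tb.
- case: B Bk tl tb => [|B] Bk tl tb.
    (* No e precedes the first cell, and [J n 0 = 0]: the block is b^(q_n). *)
    exists 0%N, (q n); rewrite div0n J0 in tb *.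
    split; [by lia| by rewrite qE; nia |by lia|].
    apply: (@gap_okp _ _ 0) => // a /andP[a0 aq].
    by rewrite -[a]add0n -(mul0n (l n * q n)) W_first_part // div0n J0 subn0.
  have [u [v [uE vE vq pv H]]] := gap B Bk.
  by exists u, v; split=> //; rewrite uE vE; lia.
- have j1 := J_lt n (B %/ k n).
  have [B1|B1] := ltnP B.+1 (k n * q n).
    have [u [v [uE vE vq pv H]]] := gap B B1.
    have j2 := J_lt n (B.+1 %/ k n).
    by exists u, v; split=> //; rewrite uE vE mulSn; lia.
  (* After the last cell there are only letters e; its row is [(q n).-1], where [J_last] gives
     exactly [p n - 2] of them. *)
  have BE : B.+1 = (k n * q n)%N by lia.
  have iE : (B %/ k n)%N = (q n).-1.
    have -> : B = ((q n).-1 * k n + (k n).-1)%N.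
      case: (q n) (k n) q0 k0 BE => [|a] [|b] //; nia.
    by rewrite divnMDl // divn_small ?addn0 //; lia.
  exists (q n.+1 - J n (q n).-1)%N, (q n.+1)%N; rewrite -iE.
  have qE' : q n.+1 = (B * (l n * q n) + l n * q n)%N by rewrite qE -BE mulSn addnC.
  split=> //; [by lia| rewrite iE J_last //; lia |].
  apply: (@gap_okp _ _ (q n.+1)) => a /andP[a1 a2]; last by lia.
  have -> : a = (B * (l n * q n) + (l n * q n - (q n.+1 - a).-1.+1))%N by lia.
  by apply: W_last_part; lia.
Qed.

(** The last cell lies in a positive row, since q_n exceeds 1 from level 1 on; [J] vanishes only on
    row 0, so this cell ends in e. *)
Lemma W_last n : (2 <= n)%N -> W n (q n).-1 = Esym.
Proof.
case: n => // n n2; have q1 := coef_q_gt1 (n2 : (0 < n)%N).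
have lq := lq_gt0 n; have k0 : (0 < k n)%N by apply: leq_trans (k2 n).
set B := (k n * q n).-1; have BE : B.+1 = (k n * q n)%N by rewrite prednK // muln_gt0 k0; lia.
have -> : (q n.+1).-1 = (B * (l n * q n) + (l n * q n - 1))%N.
  by rewrite coef_qE -BE mulSn; lia.
apply: W_last_part; first by rewrite BE.
have iq : (B %/ k n < q n)%N by rewrite ltn_divLR // mulnC -BE.
have i0 : (0 < B %/ k n)%N by rewrite divn_gt0 //; nia.
rewrite lt0n; apply/eqP => j0; have := J_eq n (B %/ k n).
by rewrite j0 muln0 mod0n modn_small // => e; rewrite -e in i0.
Qed.

(** * Leading b's and marks *)

Definition lead_b n := find (predC1 Bsym) (circ_word k l n).

Lemma lead_b_lt n : (2 <= n)%N -> (lead_b n < q n)%N.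
Proof.
move=> n2; rewrite -size_circ_word -has_find; apply/hasP; exists Esym; last by apply/eqP.
rewrite -(W_last n2) mem_nth // size_circ_word prednK //.
exact: coef_q_gt0.
Qed.

Lemma W_lead_b n : (2 <= n)%N -> W n (lead_b n) <> Bsym.
Proof.
move=> n2; apply/eqP; apply: (@nth_find _ _ (predC1 Bsym)).
by rewrite has_find size_circ_word lead_b_lt.
Qed.

Lemma W_before_lead_b n a : (a < lead_b n)%N -> W n a = Bsym.
Proof. by move=> /(before_find Bsym) /= /negbFE /eqP. Qed.

Lemma lead_bE n h : W n h <> Bsym -> (forall a, (a < h)%N -> W n a = Bsym) ->
  lead_b n = h.
Proof.
move=> hh hb; case: (ltngtP (lead_b n) h) => // hl.
  have := hb _ hl; have hs : has (predC1 Bsym) (circ_word k l n).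
    rewrite has_find; apply: leq_trans hl _; rewrite leqNgt; apply/negP => sh.
    by apply: hh; rewrite nth_default // ltnW.
  by move: (nth_find Bsym hs) => /= /eqP.
by case: hh; apply: W_before_lead_b.
Qed.

(** The word opens with a cell of row 0, where [J n 0 = 0]: [q n] letters b, then a copy of w_n,
    which exists because [2 <= l n]. *)
Lemma lead_bS n : (2 <= n)%N -> (2 <= l n)%N -> lead_b n.+1 = (q n + lead_b n)%N.
Proof.
move=> n2 l2; have kq : (0 < k n * q n)%N.
  by rewrite muln_gt0 coef_q_gt0 (leq_trans _ (k2 n)).
have copy a : (a < q n)%N -> W n.+1 (q n + a) = W n a.
  move=> aq; have [_ _ _] := @copy_pos n 0 0 a kq l2 aq.
  by rewrite !mul0n add0n div0n J0 subn0 addn0.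
apply: lead_bE; first by rewrite copy ?lead_b_lt //; exact: W_lead_b.
move=> a ah; have [aq|qa] := ltnP a (q n).
  by rewrite -[a]add0n -(mul0n (l n * q n)) W_first_part // div0n J0 subn0.
have := lead_b_lt n2 => hl.
by rewrite -(subnKC qa) copy ?W_before_lead_b //; lia.
Qed.

(** The initial run of b's is the longest one. From inside a copy the closing e is reached within
    [q n] letters; a final part of a cell is e; an initial part has at most [q n] letters b and is
    followed by a copy with [lead_b n] more. *)
Lemma no_long_b_run n s : (2 <= n)%N -> (2 <= l n)%N ->
  (s + lead_b n.+1 < q n.+1)%N ->
  exists2 a, (a <= lead_b n.+1)%N & W n.+1 (s + a) <> Bsym.
Proof.
move=> n2 l2; rewrite lead_bS // => sh.
have hl := lead_b_lt n2; have q0 := coef_q_gt0 n.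
have sq : (s < q n.+1)%N by lia.
case: (boolP (bdry n s)) => [|nb]; last first.
  have [B [c [Bk cl sE]]] := copyP sq nb; have pl := descend_lt n s.
  have qm : ((q n).-1 < q n)%N by lia.
  have [_ _ _ H] := copy_pos Bk cl qm.
  exists ((q n).-1 - descend n s)%N; first by lia.
  suff -> : (s + ((q n).-1 - descend n s) =
    B * (l n * q n) + (q n - J n (B %/ k n) + c * q n) + (q n).-1)%N by rewrite H W_last.
  by rewrite {1}sE; lia.
move: (cellP sq) sh => [B [t [Bk tl ->]]] sh; rewrite /bdry cell_offE // cell_rowE //.
have jq := J_lt n (B %/ k n).
case/orP => tb; last first.
  exists 0%N => //; rewrite addn0.
  have -> : t = (l n * q n - (l n * q n - t).-1.+1)%N by lia.
  by rewrite W_last_part //; lia.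
exists (q n - J n (B %/ k n) + lead_b n - t)%N; first by lia.
have [_ _ _ H] := @copy_pos n B 0 (lead_b n) Bk l2 hl.
suff -> : (B * (l n * q n) + t + (q n - J n (B %/ k n) + lead_b n - t) =
   B * (l n * q n) + (q n - J n (B %/ k n) + 0 * q n) + lead_b n)%N.
  by rewrite H; apply: W_lead_b.
by rewrite mul0n; lia.
Qed.

(* The block e b^(lead_b n + 1) not followed by b, with its first b at [s].  At a
   junction of level m the run of b's has length lead_b m + q_m - j_i, which lies
   strictly between lead_b m and lead_b m.+1 unless j_i = 0; so in a word of level
   above n such a block only occurs at the level-n junctions with j_i = q_n - 1. *)
Definition mark n m s := [/\ (0 < s)%N, (s + (lead_b n).+1 < q m)%N, W m s.-1 = Esym,
  (forall a, (a <= lead_b n)%N -> W m (s + a) = Bsym) & W m (s + (lead_b n).+1) <> Bsym].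

(** The first b of a mark follows an e. Among boundary letters this happens only at the start of a
    cell, which fixes the length of the run; inside a copy the run must stop before the closing
    e. *)
Lemma mark_cell n m s : (2 <= m)%N -> (2 <= l m)%N -> mark n m.+1 s ->
  (exists B, [/\ (B < k m * q m)%N, s = (B * (l m * q m))%N &
                 (lead_b n).+1 = (q m - J m (B %/ k m) + lead_b m)%N]) \/
  (~~ bdry m s /\ (descend m s + lead_b n < (q m).-1)%N).
Proof.
move=> m2 lm [s0 sh He Hb Hnb]; have hl := lead_b_lt m2; have q0 := coef_q_gt0 m.
have sq : (s < q m.+1)%N by lia.
have Hs : W m.+1 s = Bsym by rewrite -[s]addn0 Hb.
case: (boolP (bdry m s)) => [bd|nb]; [left; move: bd|right]; last first.
  split=> //; have [B [c [Bk cl sE]]] := copyP sq nb; have pl := descend_lt m s.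
  have qm : ((q m).-1 < q m)%N by lia.
  have [_ _ _ H] := copy_pos Bk cl qm; rewrite ltnNge; apply/negP => pq.
  have := Hb ((q m).-1 - descend m s)%N.
  have -> : (s + ((q m).-1 - descend m s) =
    B * (l m * q m) + (q m - J m (B %/ k m) + c * q m) + (q m).-1)%N by rewrite {1}sE; lia.
  by rewrite H W_last // => Hx; have := Hx ltac:(lia).
move: (cellP sq) s0 sh He Hb Hnb Hs => [B [t [Bk tl ->]]] s0 sh He Hb Hnb Hs.
have jq := J_lt m (B %/ k m).
rewrite /bdry cell_offE // cell_rowE // => /orP[tb|tb]; last first.
  have tE : t = (l m * q m - (l m * q m - t).-1.+1)%N by lia.
  by move: Hs; rewrite tE W_last_part //; lia.
(* Otherwise the letter before [s] would be a b of the same initial part. *)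
exists B; have t0 : t = 0%N.
  case: t tl tb He {s0 sh Hb Hnb Hs} => // t tl tb.
  by rewrite addnS /= W_first_part //; lia.
rewrite {t}t0 in tl tb s0 sh He Hb Hnb Hs *; rewrite addn0 in sh Hb Hnb *; split=> //.
have copy a : (a < q m)%N ->
   W m.+1 (B * (l m * q m) + (q m - J m (B %/ k m) + a)) = W m a.
  move=> am; have [_ _ _ <-] := @copy_pos m B 0 a Bk lm am.
  by rewrite mul0n addn0 addnA.
case: (ltngtP (lead_b n).+1 (q m - J m (B %/ k m) + lead_b m)) => // hh.
  case: Hnb; have [hq|qh] := ltnP (lead_b n).+1 (q m - J m (B %/ k m)).
    by rewrite W_first_part.
  by rewrite -(subnKC qh) copy ?W_before_lead_b //; lia.
have := Hb (q m - J m (B %/ k m) + lead_b m)%N; rewrite copy // => Hx.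
by case: (W_lead_b m2); apply: Hx.
Qed.

(** Put D = k_n l_n q_n, so that p_(n+1) = p_n D + 1 and q_(n+1) = D q_n. For s = i D + r one gets
    p_(n+1) s = D (p_n s + i) + r. Hence t and s agree modulo D, and t / D is p_n s + i modulo q_n.
    As i is the row of s, p_n times [descend n s] has the same residue. Descending a position thus
    corresponds to passing to the larger arc. *)
Lemma J_S n t (s := J n.+1 t) : (t < q n.+1)%N ->
  (s = t %[mod k n * l n * q n])%N /\ descend n s = J n (t %/ (k n * l n * q n)).
Proof.
move=> tq; set D := (k n * l n * q n)%N; have q0 := coef_q_gt0 n.
have D0 : (0 < D)%N by rewrite !muln_gt0 q0 l0 (leq_trans _ (k2 n)).
have pE : p n.+1 = (p n * D + 1)%N by rewrite coef_pS /D; lia.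
have qE : q n.+1 = (D * q n)%N by rewrite coef_qS /D; lia.
have := J_eq n.+1 t; rewrite -/s pE qE => h.
have sE := divn_eq s D; set i := (s %/ D)%N in sE; set r := (s %% D)%N in sE.
have rD : (r < D)%N by rewrite ltn_pmod.
have tE : t = (D * ((p n * s + i) %% q n) + r)%N.
  rewrite -[LHS](modn_small (m := t) (d := D * q n)); last by rewrite -qE.
  rewrite -h.
  have -> : ((p n * D + 1) * s = D * (p n * s + i) + r)%N by rewrite mulnDl mul1n {2}sE; lia.
  have := divn_eq (p n * s + i) (q n); set c := ((p n * s + i) %/ q n)%N; set d := modn _ _ => e.
  have dq : (d < q n)%N by rewrite ltn_pmod.
  have -> : (D * (p n * s + i) + r = c * (D * q n) + (D * d + r))%N by rewrite e; lia.
  by rewrite modnMDl modn_small //; nia.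
split.
  by rewrite -/r [in RHS]tE mulnC modnMDl modn_small.
have -> : (t %/ D)%N = ((p n * s + i) %% q n)%N by rewrite tE mulnC divnMDl // divn_small ?addn0.
apply/esym/J_uniq => //; first exact: descend_lt.
rewrite /descend modnMmr modn_mod mulnDr.
have -> : cell_row n s = i by rewrite /cell_row /i /D -divnMA; congr divn; lia.
rewrite -modnDmr J_eq // modnDmr -[in LHS]modnDml -[in RHS]modnDml; congr ((_ + _) %% _)%N.
rewrite -modnMmr -[in RHS]modnMmr; congr ((_ * _) %% _)%N.
by rewrite /cell_off modn_dvdm // dvdn_mull.
Qed.

(** * Levels of points of the circle *)

Variable R : realType.
Notation al n := (alpha_n k l n : R).
Notation qR n := ((q n)%:R : R).

Lemma qR_gt0 n : 0 < qR n.
Proof. by rewrite ltr0n; apply: coef_q_gt0. Qed.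

Lemma qR_ge1 n : 1 <= qR n.
Proof. by rewrite ler1n; apply: coef_q_gt0. Qed.

Lemma alpha_nS n : al n.+1 = al n + (qR n.+1)^-1.
Proof.
have k0 : (k n)%:R != 0 :> R by rewrite pnatr_eq0; have := k2 n; lia.
have l0' : (l n)%:R != 0 :> R by rewrite pnatr_eq0; have := l0 n; lia.
have q0 : qR n != 0 by rewrite pnatr_eq0; have := coef_q_gt0 n; lia.
rewrite /alpha_n coef_pS coef_qS natrD !natrM; field.
by rewrite q0 k0 l0'.
Qed.

Lemma qR_S n : 2 * qR n * qR n <= qR n.+1.
Proof. by rewrite -!natrM ler_nat; apply: leq_coef_qS. Qed.

Lemma qR_S2 n : 2 * qR n <= qR n.+1.
Proof.
apply: le_trans (qR_S n); rewrite ler_peMr ?qR_ge1 // mulr_ge0 // ltW // qR_gt0.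
Qed.

Lemma alpha_n_lt n : al n < al n.+1.
Proof. by rewrite alpha_nS ltrDl invr_gt0 qR_gt0. Qed.

Lemma alpha_n_homo : {homo alpha_n k l : m n / (m <= n)%N >-> (m <= n :> R)}.
Proof. by apply: homo_leq => // [x y z|n]; [exact: le_trans|exact/ltW/alpha_n_lt]. Qed.

(** The increment 1 / q_(n+1) and the new bound 2 / q_(n+2) <= 1 / q_(n+1) fit together into the old
    bound. *)
Lemma alpha_upper n : al n.+1 + 2 / qR n.+2 <= al n + 2 / qR n.+1.
Proof.
have h : 2 / qR n.+2 <= (qR n.+1)^-1.
  by rewrite ler_pdivrMr ?qR_gt0 // mulrC ler_pdivlMr ?qR_gt0 // qR_S2.
by rewrite alpha_nS; move: h; set a := _ / _; set b := _^-1; lra.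
Qed.

Lemma alpha_n_le m n : al m <= al n + 2 / qR n.+1.
Proof.
have H d : al (n + d) + 2 / qR (n + d).+1 <= al n + 2 / qR n.+1.
  elim: d => [|d IH]; first by rewrite addn0.
  by rewrite addnS; apply: le_trans (alpha_upper _) IH.
have P d : 0 <= 2 / qR d by rewrite divr_ge0 // ltW // qR_gt0.
have [mn|nm] := leqP m n.
  by apply: le_trans (alpha_n_homo mn) _; rewrite lerDl.
by rewrite -(subnKC (ltnW nm)); apply: le_trans (H (m - n)%N); rewrite lerDl.
Qed.

Definition rot_angle : R := sup (range (alpha_n k l)).
Notation alpha := rot_angle.

Lemma alpha_has_ub : has_ubound (range (alpha_n k l : nat -> R)).
Proof. by exists (al 0 + 2 / qR 1) => _ [n _ <-]; apply: alpha_n_le. Qed.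

Lemma alpha_n_cvg : alpha_n k l @ \oo --> alpha.
Proof. exact: (nondecreasing_cvgn alpha_n_homo alpha_has_ub). Qed.

Lemma alpha_n_lt_lim n : al n < alpha.
Proof.
apply: lt_le_trans (alpha_n_lt n) _; apply: ub_le_sup; first exact: alpha_has_ub.
by exists n.+1.
Qed.

Lemma alpha_le n : alpha <= al n + 2 / qR n.+1.
Proof.
apply: ge_sup; first by exists (al 0), 0%N.
by move=> _ [m _ <-]; apply: alpha_n_le.
Qed.

(** Liouville's argument: for a denominator d, (alpha - alpha_n) d q_n would be a positive integer,
    yet it is at most 2 d q_n / q_(n+1) <= d / q_n. *)
Lemma alpha_irrational : ~ exists r : rat, alpha = ratr r.
Proof.
case=> r ar; pose d := `|denq r|%N.
have d0 : (0 < d)%N by rewrite absz_gt0 denq_neq0.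
have dE : (d%:R : R) = (denq r)%:~R by rewrite pmulrn /d absz_denq.
have rE : alpha * d%:R = (numq r)%:~R.
  rewrite ar dE -ratr_int -rmorphM /= -[in X in X * _](divq_num_den r) divfK ?ratr_int //.
  by rewrite intr_eq0 denq_neq0.
(* [n < q n] makes d / q_n smaller than 1. *)
pose n := d.
have h1 := alpha_n_lt_lim n; have h2 := alpha_le n.
have qn := qR_gt0 n.
have z1 : alpha * d%:R * qR n - al n * qR n * d%:R = (numq r * (q n)%:Z - (p n)%:Z * d%:Z)%:~R.
  by rewrite rE /alpha_n divfK ?gt_eqF // intrB !intrM -!pmulrn.
have dR : 0 < d%:R :> R by rewrite ltr0n.
have z2 : 0 < alpha * d%:R * qR n - al n * qR n * d%:R.
  rewrite (_ : _ - _ = (alpha - al n) * d%:R * qR n); last by ring.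
  by rewrite !mulr_gt0 // subr_gt0.
have z3 : 1 <= alpha * d%:R * qR n - al n * qR n * d%:R.
  by move: z2; rewrite z1 ltr0z ler1z; lia.
have : alpha * d%:R * qR n - al n * qR n * d%:R <= 2 / qR n.+1 * d%:R * qR n.
  rewrite (_ : _ - _ = (alpha - al n) * d%:R * qR n); last by ring.
  by rewrite !ler_wpM2r ?(ltW qn) ?(ltW dR) // lerBlDl.
move/(le_trans z3); rewrite -mulrA mulrAC ler_pdivlMr ?qR_gt0 // mul1r.
move/(le_trans (qR_S n)); rewrite -mulrA ler_pM2l // ler_pM2r // ler_nat.
by have := ltn_coef_q n; rewrite /n; lia.
Qed.

(** The truncation is the index of the level-n arc that contains [th]; [J n] turns it into the
    position of w_n over this arc. *)
Definition lev n (th : R) := J n (Num.truncn (qR n * th)).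

Lemma lev_lt n th : (lev n th < q n)%N.
Proof. exact: J_lt. Qed.

Lemma truncn_qR_lt n th : 0 <= th -> th < 1 -> (Num.truncn (qR n * th) < q n)%N.
Proof.
move=> h0 h1; rewrite truncn_lt_nat ?gtr_pMr ?qR_gt0 //.
by rewrite mulr_ge0 // ltW // qR_gt0.
Qed.

Lemma levS n th : 0 <= th -> th < 1 -> descend n (lev n.+1 th) = lev n th.
Proof.
move=> h0 h1; have [_ ->] := J_S (truncn_qR_lt n.+1 h0 h1).
rewrite /lev; congr circ_j.
have -> : qR n.+1 * th = (k n * l n * q n)%:R * (qR n * th).
  by rewrite coef_qS !natrM !mulrA.
rewrite truncn_divn //; first by rewrite mulr_ge0 // ltW // qR_gt0.
by rewrite !muln_gt0 coef_q_gt0 // l0 (leq_trans _ (k2 n)).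
Qed.

Lemma lv_lev m n th : 0 <= th -> th < 1 -> (n <= m)%N -> lv m (lev m th) n = lev n th.
Proof.
move=> h0 h1; elim: m => [|m IH]; first by rewrite leqn0 => /eqP ->.
rewrite leq_eqVlt => /orP[/eqP ->|nm]; first by rewrite lv_id.
by rewrite lv_S // levS // IH.
Qed.

(* Position of [th] among the [l n] subintervals of a level-n cell: only the
   first and the last one meet the boundary letters [b] and [e]. *)
Definition subcell n (th : R) := (Num.truncn ((k n * l n * q n)%:R * th) %% l n)%N.

Definition inner n (th : R) := (0 < subcell n th)%N && ((subcell n th).+1 < l n)%N.

(** By the congruence of [J_S], the offset of the position in its cell is the arc index modulo l_n
    q_n, so avoiding the extreme pieces leaves [q n] letters on both sides. The last two bounds let
    a window of fixed width fit into the word. *)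
Lemma inner_lev n th : 0 <= th -> th < 1 -> inner n th ->
  [/\ ~~ bdry n (lev n.+1 th), (q n <= lev n.+1 th)%N & (lev n.+1 th + q n <= q n.+1)%N].
Proof.
move=> h0 h1 /andP[i0 i1]; set s := lev n.+1 th.
have q0 := coef_q_gt0 n; have lpos := l0 n.
have tq := truncn_qR_lt n.+1 h0 h1.
set t := Num.truncn _ in tq.
have [st _] := J_S tq; rewrite -/(lev n.+1 th) -/s in st.
have uE : subcell n th = ((t %/ q n) %% l n)%N.
  rewrite /subcell /t; congr modn.
  have -> : qR n.+1 * th = (q n)%:R * ((k n * l n * q n)%:R * th).
    by rewrite coef_qS !natrM; ring.
  by rewrite truncn_divn // mulr_ge0 // ler0n.
have oE : cell_off n s = (t %% (l n * q n))%N.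
  rewrite /cell_off -(@modn_dvdm (k n * l n * q n) s) ?st ?modn_dvdm //.
    by rewrite -mulnA dvdn_mull.
  by rewrite -mulnA dvdn_mull.
rewrite uE modn_divl -oE in i0 i1.
have jq := J_lt n (cell_row n s).
have o1 : (q n <= cell_off n s)%N by rewrite divn_gt0 in i0.
have o2 : (cell_off n s + q n < l n * q n)%N.
  have o3 := ltn_ceil (cell_off n s) q0.
  have : ((cell_off n s %/ q n).+2 * q n <= l n * q n)%N by rewrite leq_mul2r i1 orbT.
  by rewrite mulSn; apply: leq_trans; rewrite addnC ltn_add2l.
have sq : (s < q n.+1)%N by apply: J_lt.
split.
- rewrite /bdry negb_or -leqNgt -ltnNge.
  by move: o1 o2 jq; clear; lia.
- by apply: leq_trans o1 _; apply: leq_mod.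
- have [B [c [Bk cl sE]]] := cellP sq.
  rewrite sE cell_offE // in o2; rewrite sE coef_qE.
  have : (B.+1 * (l n * q n) <= k n * q n * (l n * q n))%N by rewrite leq_mul.
  by rewrite mulSn; move: o2; clear; lia.
Qed.

Local Hint Resolve qR_gt0 : core.

Lemma coef_pR n : (p n)%:R = al n * qR n.
Proof. by rewrite /alpha_n divfK // gt_eqF. Qed.

Lemma lev_near n (th : R) : 0 <= th -> cnear th ((lev n th)%:R * al n) (qR n)^-1.
Proof.
move=> h0; have [w hw] := modn_int_ex (J_eq n (Num.truncn (qR n * th))).
have /truncn_itv/andP[t1 t2] : 0 <= qR n * th by rewrite mulr_ge0 // ltW.
set t := Num.truncn _ in hw t1 t2.
have : (p n)%:R * (lev n th)%:R = t%:R + w%:~R * qR n.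
  have := congr1 (fun z : int => z%:~R : R) hw.
  by rewrite PoszM intrD !intrM -!pmulrn.
rewrite coef_pR => e; exists (- w); rewrite mulrNz opprK.
have q0 : qR n != 0 by rewrite gt_eqF.
rewrite -(ler_pM2l (qR_gt0 n)) mulfV // -{1}(gtr0_norm (qR_gt0 n)) -normrM.
rewrite (_ : qR n * _ = qR n * th - t%:R); last first.
  rewrite (_ : qR n * _ = qR n * th - al n * qR n * (lev n th)%:R + w%:~R * qR n); last by ring.
  by rewrite e; ring.
by rewrite -addn1 natrD in t2; rewrite ler_norml; apply/andP; split; lra.
Qed.

(** A whole subinterval, of length 1 / (k_n l_n) after scaling by q_n, separates an inner point from
    each end of its level-n arc. *)
Lemma truncn_margin n (th : R) : 0 <= th -> inner n th ->
  (Num.truncn (qR n * th))%:R + ((k n * l n)%:R)^-1 <= qR n * th /\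
  qR n * th + ((k n * l n)%:R)^-1 < (Num.truncn (qR n * th)).+1%:R.
Proof.
move=> h0 /andP[u0 u1].
have kl0 : (0 < k n * l n)%N by rewrite muln_gt0 l0 (leq_trans _ (k2 n)).
have klR : 0 < ((k n * l n)%:R : R) by rewrite ltr0n.
have qt0 : 0 <= qR n * th by rewrite mulr_ge0 // ltW.
have e : (k n * l n * q n)%:R * th = (k n * l n)%:R * (qR n * th).
  by rewrite [in LHS]natrM mulrA.
rewrite /subcell e in u0 u1.
have := truncn_divn qt0 kl0.
have /truncn_itv/andP[] : 0 <= (k n * l n)%:R * (qR n * th) by rewrite mulr_ge0.
set c := Num.truncn _ in u0 u1 *; set t := Num.truncn _ => c1 c2 ct.
have cE := divn_eq c (k n * l n); rewrite ct in cE; set c' := modn _ _ in cE.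
have cl : (c' < k n * l n)%N by rewrite ltn_pmod.
have um : (c %% l n)%N = (c' %% l n)%N by rewrite /c' modn_dvdm // dvdn_mull.
rewrite um in u0 u1; have c'E := divn_eq c' (l n).
have d : (c' %/ l n < k n)%N by rewrite ltn_divLR.
have b1 : (1 <= c')%N by apply: leq_trans u0 (leq_mod _ _).
have b2 : (c'.+2 <= k n * l n)%N.
  have : ((c' %/ l n).+1 * l n <= k n * l n)%N by rewrite leq_mul2r d orbT.
  by move: u1 c'E; rewrite mulSn; clear; lia.
have kl0' : (k n * l n)%:R != 0 :> R by rewrite gt_eqF.
split; [rewrite -(ler_pM2l klR)|rewrite -(ltr_pM2l klR)]; rewrite mulrDr mulfV //.
- apply: le_trans c1; rewrite -natrM natr1 ler_nat.
  by rewrite cE mulnC -addn1 leq_add2l.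
- apply: lt_le_trans (ltr_leD c2 (lexx 1)) _; rewrite -natrM natr1 ler_nat.
  by rewrite cE mulnS mulnC -addn2 -addnA addnC leq_add2r addn2.
Qed.

(** After a steps the rotations by alpha and alpha_n differ by at most (q_n / 2) (2 / q_(n+1));
    times q_n this is 1 / (k_n l_n), the margin of [truncn_margin]. So the point changes arcs as
    under alpha_n. *)
Lemma lev_shift n (th : R) (a : int) (b : nat) : 0 <= th -> inner n th ->
  (2 * `|a| <= q n)%N -> b%:Z = (lev n th)%:Z + a -> (b < q n)%N ->
  lev n (rotation (a%:~R * alpha) th) = b.
Proof.
move=> h0 inn aq bE bq.
have [m1 m2] := truncn_margin h0 inn.
have [z hz] := rotationP (a%:~R * alpha) th.
have r0 := rotation_ge0 (a%:~R * alpha) th.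
set th' := rotation _ _ in hz r0 *; set t := Num.truncn _ in m1 m2.
have [w hw] := modn_int_ex (J_eq n t); rewrite -/(lev n th) in hw.
have kl0 : 0 < ((k n * l n)%:R : R).
  by rewrite ltr0n muln_gt0 l0 (leq_trans _ (k2 n)).
have eps : `|qR n * a%:~R * (alpha - al n)| <= ((k n * l n)%:R)^-1.
  have a1 := alpha_n_lt_lim n; have a2 := alpha_le n.
  rewrite !normrM (gtr0_norm (qR_gt0 n)) (ger0_norm (_ : 0 <= alpha - al n)); last by lra.
  rewrite -intr_norm -[`|a|%R]abszE -pmulrn.
  apply: (@le_trans _ _ (qR n * `|a|%N%:R * (2 / qR n.+1))).
    by rewrite ler_wpM2l ?mulr_ge0 ?ler0n // lerBlDl.
  rewrite mulrA ler_pdivrMr // [leRHS]mulrC ler_pdivlMr // -!natrM ler_nat.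
  rewrite coef_qS.
  have -> : (q n * `|a| * 2 * (k n * l n) = k n * l n * q n * (2 * `|a|))%N by lia.
  by rewrite leq_mul2l aq orbT.
have qE : qR n * th' = (t%:Z + a * (p n)%:Z + (q n)%:Z * z)%:~R + 
   (qR n * th - t%:R + qR n * a%:~R * (alpha - al n)).
  by rewrite hz !intrD !intrM -!pmulrn coef_pR; ring.
move: eps; rewrite ler_norml => /andP[e1 e2].
have flE : Num.floor (qR n * th') = t%:Z + a * (p n)%:Z + (q n)%:Z * z.
  apply: floor_def; rewrite qE intrD; rewrite -addn1 natrD in m2.
  by move: e1 e2 m1 m2; set x := qR n * a%:~R * _; set y := _^-1; set v := _%:~R; lra.
have trE : (Num.truncn (qR n * th'))%:Z = t%:Z + a * (p n)%:Z + (q n)%:Z * z.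
  rewrite -flE truncn_floor mulr_ge0 ?(ltW (qR_gt0 n)) //.
  by rewrite gez0_abs // floor_ge0 mulr_ge0 // ltW.
apply: J_uniq => //; apply: (@modn_intP _ _ _ (w - z)).
rewrite trE PoszM bE mulrDr -PoszM hw; ring.
Qed.

Notation K := (circle_factor k l).

(** * Itineraries *)

Definition eventually_sym (c : sym) : set R :=
  [set th | exists n0, forall n, (n0 <= n)%N -> W n (lev n th) = c].

(** Falling through to e also gives a default value to points without an eventual letter; generic
    points always have one. *)
Definition limit_sym (th : R) : sym :=
  if `[< eventually_sym Star th >] then Star
  else if `[< eventually_sym Bsym th >] then Bsym else Esym.

Lemma limit_symE c th : eventually_sym c th -> limit_sym th = c.
Proof.
move=> ec; have U c' : eventually_sym c' th -> c' = c.
  move: ec => [n0 h0] [n1 h1].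
  by rewrite -(h0 (maxn n0 n1)) ?leq_maxl // h1 // leq_maxr.
rewrite /limit_sym; case: asboolP => [/U //|nS].
case: asboolP => [/U //|nB].
by case: c ec nS nB {U}.
Qed.

Lemma W_descend n s : (s < q n.+1)%N -> ~~ bdry n s -> W n.+1 s = W n (descend n s).
Proof.
move=> sq nb; have [B [c [Bk cl sE]]] := copyP sq nb.
have [_ _ _ <-] := copy_pos Bk cl (descend_lt n s).
by rewrite -sE.
Qed.

Lemma limit_sym_inner th n0 : 0 <= th -> th < 1 ->
  (forall n, (n0 <= n)%N -> inner n th) ->
  forall n, (n0 <= n)%N -> limit_sym th = W n (lev n th).
Proof.
move=> h0 h1 inn n nn; apply: limit_symE; exists n => m /subnKC <-.
elim: (m - n)%N => [|d IH]; first by rewrite addn0.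
rewrite addnS -IH -[lev (n + d)%N th]levS //; apply: W_descend; first exact: lev_lt.
by have [] := inner_lev h0 h1 (inn (n + d)%N (leq_trans nn (leq_addr _ _))).
Qed.

(** Irrational points are never ends of arcs, which [recover] needs. *)
Definition generic : set R := [set th | [/\ 0 <= th, th < 1, forall r : rat, th <> ratr r &
  exists n0, forall n, (n0 <= n)%N -> inner n th]].

Definition orbit_generic : set R := [set th | [/\ 0 <= th, th < 1 &
  forall a : int, generic (rotation (a%:~R * alpha) th)]].

Definition coding (th : R) : bisequence :=
  fun a => limit_sym (rotation (a%:~R * alpha) th).

Lemma rotation_int (a b : int) th : rotation (b%:~R * alpha) (rotation (a%:~R * alpha) th) =
  rotation ((a + b)%:~R * alpha) th.
Proof. by rewrite rotationD -mulrDl -intrD. Qed.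

Lemma orbit_generic_generic th : orbit_generic th -> generic th.
Proof. by move=> [h0 h1 /(_ 0)]; rewrite mul0r rotation0. Qed.

Lemma orbit_generic_rotation (a : int) th : orbit_generic th ->
  orbit_generic (rotation (a%:~R * alpha) th).
Proof.
move=> [h0 h1 g]; split; rewrite ?rotation_ge0 ?rotation_lt1 // => b.
by rewrite rotation_int.
Qed.

Lemma coding_shift (a b : int) th :
  coding (rotation (b%:~R * alpha) th) a = coding th (a + b).
Proof. by rewrite /coding rotation_int addrC. Qed.

(** An occurrence of a window in w_m that remembers the position of index 0, which the infix
    relation in [circle_factor] forgets. *)
Definition parsed (x : bisequence) m s M := (s < q m)%N /\
  forall a : int, (`|a| <= M)%N -> exists c : nat,
    [/\ c%:Z = s%:Z + a, (c < q m)%N & x a = W m c].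

Lemma parsed_le x m s M M' : (M' <= M)%N -> parsed x m s M -> parsed x m s M'.
Proof. by move=> MM [sq h]; split=> // a aM; apply: h; apply: leq_trans MM. Qed.

Lemma coding_parsed th M : orbit_generic th ->
  exists n1, forall n, (n1 <= n)%N -> parsed (coding th) n (lev n th) M.
Proof.
move=> og; have [h0 h1 _ [n0 inn]] := orbit_generic_generic og.
have [n1 hn1] : exists n1, forall n, (n1 <= n)%N -> forall a : int, (`|a| <= M)%N ->
    coding th a = W n (lev n (rotation (a%:~R * alpha) th)).
  have one (a : int) : exists n1, forall n, (n1 <= n)%N ->
      coding th a = W n (lev n (rotation (a%:~R * alpha) th)).
    have [_ _ /(_ a)[g0 g1 _ [na hna]]] := og.
    by exists na => n nn; apply: limit_sym_inner nn.
  elim: (M) => [|M' [n1 IH]].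
    have [n1 hn1] := one 0; exists n1 => n nn a.
    by rewrite leqn0 absz_eq0 => /eqP ->; apply: hn1.
  have [n2 hn2] := one M'.+1%:Z; have [n3 hn3] := one (- M'.+1%:Z).
  exists (maxn n1 (maxn n2 n3)) => n; rewrite !geq_max => /andP[nn1 /andP[nn2 nn3]] a.
  rewrite leq_eqVlt => /orP[/eqP aM|]; last exact: IH.
  have [->|->] : a = M'.+1%:Z \/ a = - M'.+1%:Z by clear -aM; lia.
    exact: hn2.
  exact: hn3.
(* The successor appears because [inner] at level n gives room at level n + 1: at least
   [q n >= 2 * M] letters on each side. *)
exists (maxn n1 (maxn n0 (2 * M))).+1 => [[//|n]]; rewrite ltnS !geq_max.
move=> /andP[nn1 /andP[nn0 nM]]; split; first exact: lev_lt.
move=> a aM; have [_ b1 b2] := inner_lev h0 h1 (inn n nn0).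
have qM : (2 * M <= q n)%N by apply: leq_trans nM (ltnW (ltn_coef_q n)).
have qq : (q n <= q n.+1)%N by apply: coef_q_homo.
exists (absz ((lev n.+1 th)%:Z + a)%R).
have bE : (absz ((lev n.+1 th)%:Z + a)%R)%:Z = (lev n.+1 th)%:Z + a.
  by apply: gez0_abs; clear -aM b1 qM; lia.
have q0 := coef_q_gt0 n.
have bq : ((absz ((lev n.+1 th)%:Z + a)%R) < q n.+1)%N.
  by move: bE; set b := absz _; clear -aM b2 qM q0; lia.
split=> //; rewrite (hn1 n.+1) //; last exact: leq_trans nn1 (leqnSn _).
congr nth; apply: lev_shift => //; first by apply: inn; apply: leq_trans nn0 _.
by clear -aM qM qq; lia.
Qed.

Lemma circle_factorP (x : symZ) : K x <-> forall M, exists m s, parsed x m s M.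
Proof.
split=> [Kx M|H m0 len].
  have [m /infixP[pr [sf wE]]] := Kx (- M%:Z) (2 * M).+1.
  have sz : size (block x (- M%:Z) (2 * M).+1) = (2 * M).+1.
    by rewrite /block size_map size_iota.
  have qE : q m = (size pr + (2 * M).+1 + size sf)%N.
    by rewrite -size_circ_word wE !size_cat sz addnA.
  exists m, (size pr + M)%N; split; first by rewrite qE; clear; lia.
  move=> a aM; exists (size pr + absz (M%:Z + a)%R)%N.
  have e : (absz (M%:Z + a)%R)%:Z = M%:Z + a by apply: gez0_abs; clear -aM; lia.
  have e2 : (absz (M%:Z + a)%R < (2 * M).+1)%N by move: e; set b := absz _; clear -aM; lia.
  split; [by rewrite !PoszD e addrA | by rewrite qE -!addnA ltn_add2l ltn_addr|].
  rewrite wE nth_cat ifF; last by apply/negbTE; rewrite -leqNgt leq_addr.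
  rewrite addKn nth_cat sz e2 /block (nth_map 0%N) ?size_iota // nth_iota //.
  by congr x; rewrite add0n e addrA addNr add0r.
have [len0|len0] := posnP len; first by exists 0%N; rewrite len0; apply: infix0s.
have [m [s [sq h]]] := H (`|m0| + len)%N.
have [|c0 [c0E c0q _]] := h m0; first exact: leq_addr.
have get i : (i < len)%N -> (c0 + i < q m)%N /\ x (m0 + i%:Z) = W m (c0 + i).
  move=> il; have [|c [cE cq xc]] := h (m0 + i%:Z); first by clear -il; lia.
  have -> : (c0 + i)%N = c by clear -cE c0E; lia.
  by [].
have cl : (c0 + len <= q m)%N.
  have [|+ _] := get len.-1; first by rewrite prednK.
  by clear -len0; lia.
exists m; apply/infixP; exists (take c0 (circ_word k l m)), (drop (c0 + len) (circ_word k l m)).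
have -> : block x m0 len = take len (drop c0 (circ_word k l m)).
  apply: (@eq_from_nth _ Bsym).
    by rewrite size_map size_iota size_takel // size_drop size_circ_word //; clear -cl; lia.
  rewrite size_map size_iota => i il.
  rewrite (nth_map 0%N) ?size_iota // nth_iota // add0n nth_take // nth_drop.
  by have [_ ->] := get i il.
by rewrite addnC -drop_drop cat_take_drop cat_take_drop.
Qed.

Lemma circle_factor_parsed_above (x : symZ) M m0 : K x ->
  exists m s, (m0 < m)%N /\ parsed x m s M.
Proof.
(* A window wider than w_m0 fits into no word of level at most [m0]. *)
move=> /circle_factorP /(_ (maxn M (q m0)))[m [s P]].
exists m, s; split; last by apply: parsed_le P; apply: leq_maxl.
rewrite ltnNge; apply/negP => /coef_q_homo mm.
have [|c [cE cq _]] := P.2 (maxn M (q m0))%:Z; first by [].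
by have := leq_maxr M (q m0); clear -cE cq mm; lia.
Qed.

Definition has_mark (x : bisequence) n (a : int) := [/\ x (a - 1) = Esym,
  (forall c : nat, (c <= lead_b n)%N -> x (a + c%:Z) = Bsym) &
  x (a + (lead_b n).+1%:Z) <> Bsym].

Lemma parsed_mark x m s M n a : parsed x m s M -> (`|a| + lead_b n < M)%N ->
  has_mark x n a -> exists c : nat, c%:Z = s%:Z + a /\ mark n m c.
Proof.
move=> [sq h] aM [xe xb xn].
have [|c [cE cq xc]] := h a; first by clear -aM; lia.
have at_ i : (i <= (lead_b n).+1)%N -> (c + i < q m)%N /\ x (a + i%:Z) = W m (c + i).
  move=> il; have [|d [dE dq xd]] := h (a + i%:Z); first by clear -aM il; lia.
  by have -> : (c + i)%N = d by clear -cE dE; lia.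
have [|d [dE dq xd]] := h (a - 1); first by clear -aM; lia.
exists c; split=> //; have c0 : (0 < c)%N by clear -cE dE; lia.
split=> //.
- by have [] := at_ (lead_b n).+1.
- by rewrite -xe xd; congr nth; clear -cE dE; lia.
- by move=> i il; have [_ <-] := at_ i (leqW il); apply: xb.
- by have [|_ <-] := at_ (lead_b n).+1.
Qed.

Lemma has_mark_shift b x n a : has_mark (shiftz b x) n a <-> has_mark x n (a + b).
Proof.
have e c : shiftz b x (a + c) = x (a + b + c) by rewrite /shiftz addrAC.
by rewrite /has_mark /has_mark !e; split=> -[h1 h2 h3]; split=> // c cl;
  [rewrite -e|rewrite e]; apply: h2.
Qed.

Lemma circle_factor_shift b (x : symZ) : K x -> K (shiftz b x).
Proof.
move=> Kx m len; have [n] := Kx (m + b) len.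
suff -> : block x (m + b) len = block (shiftz b x) m len by exists n.
by apply: eq_map => i; rewrite /shiftz addrAC.
Qed.

Lemma qRV_small (c e : R) : 0 < e -> exists n0, forall n, (n0 <= n)%N -> c / qR n <= e.
Proof.
move=> e0; exists (Num.truncn (c / e)).+1 => n nn.
rewrite ler_pdivrMr // mulrC -ler_pdivrMr //.
apply: le_trans (ltW (truncnS_gt _)) _; rewrite ler_nat.
exact: leq_trans nn (ltnW (ltn_coef_q n)).
Qed.

Lemma alpha_approx (a : int) (e : R) : 0 < e ->
  exists m0, forall m, (m0 <= m)%N -> `|a%:~R * (alpha - al m)| <= e.
Proof.
move=> e0; have [n0 h] := qRV_small (`|a|%:~R * 2) e0.
exists n0 => m mm; apply: le_trans (h m.+1 (leq_trans mm (leqnSn _))).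
have a1 := alpha_n_lt_lim m; have a2 := alpha_le m.
rewrite normrM (ger0_norm (_ : 0 <= alpha - al m)); last by lra.
by rewrite intr_norm -mulrA ler_wpM2l // lerBlDl.
Qed.

Lemma cnear_last_position n : cnear ((q n).-1%:R * al n) (- al n) 0.
Proof.
have q0 := coef_q_gt0 n; apply: (@cnear_int _ _ _ (p n)%:Z).
by rewrite -pmulrn coef_pR -subn1 natrB //; ring.
Qed.

(** Left end of the level-m arc under position [s]. *)
Definition word_point m s : R := ((p m * s) %% q m)%:R / qR m.

Lemma word_pointP m s : (s < q m)%N ->
  [/\ 0 <= word_point m s, word_point m s < 1, lev m (word_point m s) = s &
      cnear (word_point m s) (s%:R * al m) 0].
Proof.
move=> sq; have q0 := coef_q_gt0 m.
have tq : ((p m * s) %% q m < q m)%N by rewrite ltn_pmod.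
have qne : qR m != 0 by rewrite gt_eqF.
split.
- by rewrite divr_ge0.
- by rewrite ltr_pdivrMr // mul1r ltr_nat.
- rewrite /lev /word_point mulrC divfK // natrK.
  by apply: J_uniq => //; rewrite modn_mod.
- apply: (@cnear_int _ _ _ (- ((p m * s) %/ q m)%N%:Z)).
  rewrite /word_point /alpha_n mulrNz -pmulrn.
  have /(congr1 (fun z => z%:R : R)) := divn_eq (p m * s) (q m).
  rewrite natrD !natrM => e; apply: (mulIf qne).
  rewrite divfK // mulrBl mulrA divfK // [s%:R * _]mulrC e; ring.
Qed.

(** * Measurability of codings, generic points and marks *)

Lemma measurable_lev n (P : set nat) : measurable [set th : R | P (lev n th)].
Proof. exact: (measurable_truncn_mul (qR n) (fun t => P (J n t))). Qed.

Lemma measurable_inner n : measurable [set th : R | inner n th].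
Proof.
exact: (measurable_truncn_mul (k n * l n * q n)%:R
  (fun t => (0 < t %% l n)%N && ((t %% l n).+1 < l n)%N)).
Qed.

Lemma measurable_limit_sym c : measurable [set th : R | limit_sym th = c].
Proof.
have mev c' : measurable (eventually_sym c').
  apply: measurable_ex => n0; apply: measurable_all => n.
  apply: measurable_imp => _; exact: (measurable_lev n (fun s => W n s = c')).
rewrite [X in measurable X](_ : _ = [set th | (eventually_sym Star th /\ Star = c) \/
  (~ eventually_sym Star th /\ ((eventually_sym Bsym th /\ Bsym = c) \/
    (~ eventually_sym Bsym th /\ Esym = c)))]).
  have mp := @measurable_prop _ (measurableTypeR R).
  apply: measurable_disj.
    by apply: measurable_conj; [exact: mev|exact: mp].
  apply: measurable_conj; first by apply: measurable_compl; exact: mev.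
  apply: measurable_disj; apply: measurable_conj; [exact: mev|exact: mp| |exact: mp].
  by apply: measurable_compl; exact: mev.
apply/seteqP; split=> th /=; rewrite /limit_sym.
  case: asboolP => hs; first by left.
  by case: asboolP => hb; right; split=> //; [left|right].
case: asboolP => hs; first by case=> [[]|[]].
by case: asboolP => hb [[]|[_ [[]|[]]]].
Qed.

Lemma measurable_coding : measurable_fun setT (coding : R -> symZ).
Proof.
apply: (@measurability _ _ (measurableTypeR R) symZ setT coding cylinders) => //.
move=> _ [_ [i [c ->]] <-].
exact: (measurable_rotation _ measurableT (measurable_limit_sym c)).
Qed.

Lemma measurable_generic : measurable generic.
Proof.
rewrite (_ : generic = [set th | ((0 <= th /\ th < 1) /\ (forall r : rat, th <> ratr r)) /\
  exists n0, forall n, (n0 <= n)%N -> inner n th]); last first.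
  apply/seteqP; split=> th /= => [[h1 h2 h3 h4]|[[[h1 h2] h3] h4]]; last by split.
  exact: (conj (conj (conj h1 h2) h3) h4).
apply: measurable_conj; [apply: measurable_conj|].
- rewrite [X in measurable X](_ : _ = `[0, 1[%classic) //.
  by apply/seteqP; split=> x /=; rewrite in_itv /=; [move=> [-> ->]|move/andP].
- by apply: measurable_all => r; apply: measurable_compl; exact: measurable_set1.
- apply: measurable_ex => n0; apply: measurable_all => n; apply: measurable_imp => _.
  exact: measurable_inner.
Qed.

Lemma measurable_orbit_generic : measurable orbit_generic.
Proof.
rewrite (_ : orbit_generic = [set th | unit_interval th /\
  forall a : int, generic (rotation (a%:~R * alpha) th)]); last first.
  by apply/seteqP; split=> th /=; [move=> []|move=> [[]]].
apply: measurable_conj; first exact: measurable_unit_interval.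
apply: measurable_all => a; rewrite -[X in measurable X]setTI.
exact: (measurable_rotation _ measurableT measurable_generic).
Qed.

Lemma measurable_has_mark n a : measurable [set x : symZ | has_mark x n a].
Proof.
rewrite [X in measurable X](_ : _ = [set x : symZ | (x (a - 1) = Esym /\
  (forall c : nat, (c <= lead_b n)%N -> x (a + c%:Z) = Bsym)) /\
  ~ x (a + (lead_b n).+1%:Z) = Bsym]); last first.
  by apply/seteqP; split=> th /=; [move=> []|move=> [[]]].
apply: measurable_conj; last by apply: measurable_compl; exact: measurable_letter.
apply: measurable_conj; first exact: measurable_letter.
apply: measurable_all => c; apply: measurable_imp => _; exact: measurable_letter.
Qed.

(** The block is replaced by a quantified list [u], which ranges over a countable type, so that only
    conditions on single letters of [x] remain. *)
Lemma measurable_circle_factor : measurable (K : set symZ).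
Proof.
apply: measurable_all => m; apply: measurable_all => len; apply: measurable_ex => n.
rewrite [X in measurable X](_ : _ = [set x : symZ | exists u : seq sym,
   (size u = len /\ infix u (circ_word k l n)) /\
   forall i : nat, (i < len)%N -> x (m + i%:Z) = nth Bsym u i]); last first.
  apply/seteqP; split=> x /=.
    move=> h; exists (block x m len); rewrite size_map size_iota; split=> // i il.
    by rewrite (nth_map 0%N) ?size_iota // nth_iota.
  move=> [u [[su iu] h]]; suff -> : block x m len = u by [].
  apply: (@eq_from_nth _ Bsym); rewrite size_map size_iota // => i il.
  by rewrite (nth_map 0%N) ?size_iota // nth_iota // h.
apply: measurable_ex => u; apply: measurable_conj; first exact: measurable_prop.
apply: measurable_all => i; apply: measurable_imp => _; exact: measurable_letter.
Qed.

Notation U := (@unit_interval R).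
Local Notation mR := (measurableTypeR R).

(** * Rotation invariant measures and generic points *)

Section InvariantMeasures.
Hypothesis l_small : forall e : R, 0 < e ->
  exists n0, forall n, (n0 <= n)%N -> ((l n)%:R)^-1 <= e.

Let width n : R := (1 + 2 / (l n)%:R) / qR n.

Lemma width_gt0 n : 0 < width n.
Proof.
rewrite divr_gt0 // ltr_wpDr // divr_ge0 //.
Qed.

Lemma iter_rotation s y : U y -> iter s (rotation alpha) y = rotation (s%:R * alpha) y.
Proof.
move=> [y0 y1]; elim: s => [|s IH] /=; first by rewrite mul0r rotation0.
by rewrite IH rotationD; congr rotation; rewrite -natr1; ring.
Qed.

(* The first q_n points of an orbit are the points y + t / q_n, up to an error of
   at most 2 / (l_n q_n). *)
Lemma orbit_hits n u y : 0 <= u -> u + width n <= 1 -> U y ->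
  exists2 s, (s < q n)%N & u <= iter s (rotation alpha) y < u + width n.
Proof.
move=> u0 u1 Uy; have q0 := qR_gt0 n; have qn0 := coef_q_gt0 n.
(* The first point [y + t / q n] not below [u]; the iterate [s] with p_n s = t modulo q_n reaches it
   up to the drift [d]. *)
pose t := Num.ceil (qR n * (u - y)).
pose t' := absz (t %% (q n)%:Z)%Z.
have t'E : t'%:Z = (t %% (q n)%:Z)%Z by rewrite /t' gez0_abs // modz_ge0 //; lia.
have tE : t = t'%:Z + (t %/ (q n)%:Z)%Z * (q n)%:Z by rewrite t'E addrC -divz_eq.
have [w hw] := modn_int_ex (J_eq n t').
set s := J n t' in hw; have sq : (s < q n)%N by apply: J_lt.
exists s => //; rewrite iter_rotation //.
have a1 := alpha_n_lt_lim n; have a2 := alpha_le n.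
pose d := s%:R * (alpha - al n).
have d0 : 0 <= d by rewrite mulr_ge0 // subr_ge0 ltW.
have lR : 0 < (l n)%:R :> R by rewrite ltr0n.
have d1 : d <= 2 / (l n)%:R / qR n.
  apply: (@le_trans _ _ (qR n * (2 / qR n.+1))).
    apply: ler_pM => //; first by rewrite subr_ge0 ltW.
      by rewrite ler_nat ltnW.
    by rewrite lerBlDl.
  have kR : 0 < (k n)%:R :> R by rewrite ltr0n; apply: leq_trans (k2 n).
  rewrite (_ : qR n * _ = 2 / (l n)%:R / qR n * (k n)%:R^-1); last first.
    by rewrite coef_qS !natrM; field; rewrite !gt_eqF.
  rewrite ler_piMr // ?divr_ge0 // ?(ltW q0) // invf_le1 // ler1n.
  exact: leq_trans (k2 n).
have sE : s%:R * alpha = t%:~R / qR n + d + (w - (t %/ (q n)%:Z)%Z)%:~R.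
  have e1 : (p n)%:R * s%:R = t'%:R + w%:~R * qR n.
    have := congr1 (fun z : int => z%:~R : R) hw.
    by rewrite PoszM intrD !intrM -!pmulrn.
  have e2 : t%:~R = t'%:R + (t %/ (q n)%:Z)%Z%:~R * qR n.
    by rewrite [in LHS]tE intrD intrM -!pmulrn.
  rewrite e2 intrB /d.
  rewrite (_ : t'%:R = al n * qR n * s%:R - w%:~R * qR n); last by rewrite -coef_pR e1; ring.
  by field; rewrite gt_eqF.
have tq : qR n * (t%:~R / qR n) = t%:~R by rewrite mulrC divfK // gt_eqF.
have t1 : qR n * (u - y) <= t%:~R by apply: ceil_ge.
have t2 : t%:~R < qR n * (u - y) + 1.
  by have := ceilB1_lt (qR n * (u - y)); rewrite -/t intrB; lra.
have c1 : u <= y + t%:~R / qR n by rewrite -lerBlDl -(ler_pM2l q0) tq.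
have c2 : y + t%:~R / qR n < u + (qR n)^-1.
  rewrite -ltrBrDl -(ltr_pM2l q0) tq (_ : qR n * _ = qR n * (u - y) + 1) //.
  by field; rewrite gt_eqF.
rewrite (@rotation_uniq _ _ _ (y + t%:~R / qR n + d) ((t %/ (q n)%:Z)%Z - w)).
- by rewrite (le_trans c1) ?lerDl //= /width mulrDl mul1r addrA ltr_leD.
- by rewrite addr_ge0 // (le_trans u0).
- apply: lt_le_trans u1; rewrite /width mulrDl mul1r addrA ltr_leD //.
- by rewrite sE !intrB; ring.
Qed.

Section Unique.
Variable m : {measure set mR -> \bar R}.
Hypothesis mT : m setT = 1%E.
Hypothesis mU : m U = 1%E.
Hypothesis minv : forall A : set mR, measurable A -> m (rotation alpha @^-1` A) = m A.

Lemma measurable_iter_rotation s (A : set mR) : measurable A ->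
  measurable (iter s (rotation alpha) @^-1` A : set mR).
Proof.
elim: s A => // s IH A mA.
rewrite (_ : _ @^-1` _ = iter s (rotation alpha) @^-1` (rotation alpha @^-1` A)) //.
by apply: IH; rewrite -[X in measurable X]setTI; exact: (@measurable_rotation R alpha).
Qed.

Lemma invariant_iter s (A : set mR) : measurable A -> m (iter s (rotation alpha) @^-1` A) = m A.
Proof.
elim: s A => // s IH A mA.
rewrite (_ : _ @^-1` _ = iter s (rotation alpha) @^-1` (rotation alpha @^-1` A)) //.
by rewrite IH ?minv //; exact: (@measurable_iter_rotation 1).
Qed.

(** By [orbit_hits] the preimages of the interval under the first [q n] iterates cover [U], and all
    have the same measure. *)
Lemma invariant_width n (u : R) : 0 <= u -> u + width n <= 1 ->
  ((qR n)^-1%:E <= m `[u, (u + width n)%R[%classic)%E.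
Proof.
move=> u0 u1; set A : set mR := `[u, u + width n[%classic.
have mA : measurable A by exact: measurable_itv.
have h0 : (m U <= \sum_(s < q n) m (iter s (rotation alpha) @^-1` A))%E.
  apply: (@content_subadditive _ _ _ m U (fun s => iter s (rotation alpha) @^-1` A)).
  - by move=> s _; apply: measurable_iter_rotation.
  - exact: measurable_unit_interval.
  - move=> y Uy; have [s sq h] := orbit_hits u0 u1 Uy.
    by rewrite -(bigcup_mkord (q n) (fun s => iter s (rotation alpha) @^-1` A)); exists s => //=; rewrite in_itv.
move: h0; rewrite mU (eq_bigr (fun=> m A)) => [|s _]; last exact: invariant_iter.
have := mu_fin mT mA; move: (m A) => [r| |] // _.
rewrite sumEFin sumr_const card_ord !lee_fin => h.
by rewrite -div1r ler_pdivrMr // mulr_natr.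
Qed.

Lemma invariant_blocks n c (u : R) : 0 <= u -> u + c%:R * width n <= 1 ->
  ((c%:R / qR n)%:E <= m `[u, (u + c%:R * width n)%R[%classic)%E.
Proof.
elim: c => [|c IH] u0 u1; first by rewrite mul0r measure_ge0.
have w0 := width_gt0 n.
have u1' : u + c%:R * width n <= 1.
  by apply: le_trans u1; rewrite lerD2l ler_pM2r // ler_nat.
rewrite (@itvco_split _ u (u + c%:R * width n)); last first.
- by rewrite lerD2l ler_pM2r // ler_nat.
- by rewrite lerDl mulr_ge0 // ltW.
rewrite measureU //; last exact: itvco_disj.
rewrite -natr1 mulrDl EFinD mul1r; apply: leeD; first exact: IH.
rewrite (_ : (u + (c%:R + 1) * width n)%R = (u + c%:R * width n + width n)%R); last by ring.
apply: invariant_width; first by rewrite addr_ge0 // mulr_ge0 // ltW.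
by move: u1; rewrite -natr1 mulrDl mul1r addrA.
Qed.

(** The interval is filled with disjoint ones of length [width n]; this length is asymptotic to 1 /
    q_n since l_n tends to infinity, so nothing is lost in the limit. *)
Lemma invariant_itv_ge (u v : R) : 0 <= u -> u <= v -> v <= 1 ->
  ((v - u)%:E <= m `[u, v[%classic)%E.
Proof.
move=> u0 uv v1; have mA : measurable (`[u, v[%classic : set mR) by exact: measurable_itv.
have fA := mu_fin mT mA; have leA : (m `[u, v[%classic <= 1)%E.
  by rewrite -mT le_measure ?inE.
have H n : (((Num.truncn ((v - u) / width n)%R)%:R / qR n)%:E <= m `[u, v[%classic)%E.
  set c := Num.truncn _; have w0 := width_gt0 n.
  have /truncn_itv/andP[c1 _] : 0 <= (v - u) / width n by rewrite divr_ge0 ?subr_ge0 // ltW.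
  rewrite -/c ler_pdivlMr // in c1.
  have cv : u + c%:R * width n <= v by rewrite -lerBrDl.
  apply: le_trans (invariant_blocks u0 (le_trans cv v1)) _.
  apply: le_measure; rewrite ?inE //.
  by move=> y /=; rewrite !in_itv /= => /andP[-> h2] /=; apply: lt_le_trans cv.
have [r rE] : exists r, m `[u, v[%classic = r%:E by exists (fine (m `[u, v[%classic)); rewrite fineK.
rewrite rE lee_fin in leA *; apply/ler_addgt0Pr => e e0.
(* The loss is at most 2 / l_n + 3 / q_n, which becomes at most 3 e / 4. *)
have e4 : 0 < e / 4 by rewrite divr_gt0.
have [n1 h1] := l_small e4; have [n2 h2] := qRV_small 3 e4.
pose n := maxn n1 n2; have g1 := h1 n (leq_maxl _ _); have g2 := h2 n (leq_maxr _ _).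
have := H n; rewrite rE lee_fin; set c := Num.truncn _ => hc.
have w0 := width_gt0 n.
have /truncn_itv/andP[_ c2] : 0 <= (v - u) / width n by rewrite divr_ge0 ?subr_ge0 // ltW.
rewrite -/c ltr_pdivrMr // -natr1 mulrDl mul1r in c2.
have lR : 0 < (l n)%:R :> R by rewrite ltr0n.
have cE : c%:R * width n = (c%:R / qR n) * (1 + 2 / (l n)%:R) by rewrite /width; ring.
have x0 : 0 <= (l n)%:R^-1 :> R by rewrite invr_ge0.
have r0 : 0 <= r by rewrite -lee_fin -rE measure_ge0.
have b1 : c%:R * width n <= r + 2 * (l n)%:R^-1.
  rewrite cE (@le_trans _ _ (r * (1 + 2 / (l n)%:R))) //.
    by rewrite ler_wpM2r // addr_ge0 // mulr_ge0.
  rewrite mulrDr mulr1 lerD2l -[leRHS]mul1r ler_wpM2r // mulr_ge0 //.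
have b2 : width n <= 3 / qR n.
  rewrite ler_pM2r ?invr_gt0 //.
  have : (l n)%:R^-1 <= 1 :> R by rewrite invf_le1 // ler1n.
  by set x := _^-1; lra.
by move: b1 b2 c2 g1 g2; set x := _^-1; set y := width n; set z := 3 / _; lra.
Qed.

Lemma invariant_unique A : measurable A -> m A = circle_measure R A.
Proof.
move=> mA; apply: circle_measure_unique => // x /andP[x0 x1].
have m1 : measurable (`[0, x[%classic : set mR) by exact: measurable_itv.
have m2 : measurable (`[x, 1[%classic : set mR) by exact: measurable_itv.
have h1 := invariant_itv_ge (lexx 0) x0 x1; have h2 := invariant_itv_ge x0 x1 (lexx 1).
have : m U = (m `[0%R, x[%classic + m `[x, 1%R[%classic)%E.
  rewrite -measureU //; last exact: itvco_disj.
  by rewrite unit_intervalE (@itvco_split _ _ x).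
move: h1 h2; rewrite mU; have := mu_fin mT m1; have := mu_fin mT m2.
move: (m `[0%R, x[%classic) (m `[x, 1%R[%classic) => [r| |] // [s| |] // _ _.
rewrite !lee_fin => g1 g2; rewrite -EFinD => -[g3]; congr EFin; lra.
Qed.

End Unique.

End InvariantMeasures.

(** * Almost every orbit is generic *)

Section GenericPoints.
Hypothesis l_sum : (\sum_(0 <= n <oo) (((l n)%:R : R)^-1)%:E < +oo)%E.

Definition outer n : set mR := [set th | U th /\ ~ inner n th].

Lemma measurable_outer n : measurable (outer n).
Proof.
apply: (@measurable_conj _ mR U (fun th => ~ inner n th)).
  exact: measurable_unit_interval.
exact: (@measurable_compl _ mR (fun th => inner n th) (measurable_inner n)).
Qed.

(** There are k_n q_n groups of l_n pieces, and each contributes its first and its last piece, of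
    length 1 / (k_n l_n q_n). *)
Lemma outer_le n : (circle_measure R (outer n) <= (2 / (l n)%:R)%:E)%E.
Proof.
set a := (k n * l n * q n)%N.
have a0 : (0 < a)%N by rewrite !muln_gt0 coef_q_gt0 // l0 (leq_trans _ (k2 n)).
have aR : 0 < a%:R :> R by rewrite ltr0n.
pose A c : set mR := `[(c * l n)%:R / a%:R, (c * l n).+1%:R / a%:R[%classic.
pose B c : set mR := `[(c.+1 * l n).-1%:R / a%:R, (c.+1 * l n)%:R / a%:R[%classic.
have hA c : (circle_measure R (A c) <= (a%:R^-1)%:E)%E.
  apply: le_trans (circle_measure_itv_le _) _.
    by rewrite ler_pM2r ?invr_gt0 // ler_nat.
  by rewrite lee_fin -mulrBl -natrB // subSnn mul1r.
have hB c : (circle_measure R (B c) <= (a%:R^-1)%:E)%E.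
  apply: le_trans (circle_measure_itv_le _) _.
    by rewrite ler_pM2r ?invr_gt0 // ler_nat leq_pred.
  have cl : (0 < c.+1 * l n)%N by rewrite muln_gt0 l0.
  by rewrite lee_fin -mulrBl -natrB ?leq_pred // -subn1 subKn // mul1r.
have mA c : measurable (A c) by exact: measurable_itv.
have mB c : measurable (B c) by exact: measurable_itv.
have : (circle_measure R (outer n) <= \sum_(c < k n * q n) circle_measure R (A c `|` B c))%E.
  apply: (@content_subadditive _ _ _ (circle_measure R) _ (fun c => A c `|` B c)).
  - by move=> c _; apply: measurableU.
  - exact: measurable_outer.
  - move=> th [[t0 t1] /negP ni].
    rewrite -(bigcup_mkord (k n * q n) (fun c => A c `|` B c)).
    have /truncn_itv/andP[b1 b2] : 0 <= a%:R * th by rewrite mulr_ge0.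
    rewrite /inner /subcell -/a in ni; set T := Num.truncn _ in ni b1 b2.
    have Ta : (T < a)%N by rewrite -(ltr_nat R) (le_lt_trans b1) // gtr_pMr.
    have TE := divn_eq T (l n); have Tl := ltn_pmod T (l0 n).
    exists (T %/ l n)%N => /=.
      by rewrite ltn_divLR //; move: Ta; rewrite /a; clear; lia.
    have thE : T%:R / a%:R <= th /\ th < T.+1%:R / a%:R.
      by rewrite ler_pdivrMr // ltr_pdivlMr // mulrC.
    move: ni; rewrite negb_and -eqn0Ngt -leqNgt => /orP[/eqP u0|u1]; [left|right].
      rewrite u0 addn0 in TE; rewrite /A /= in_itv /= -TE.
      by apply/andP.
    have TE' : T.+1 = ((T %/ l n).+1 * l n)%N.
      by rewrite mulSn; move: TE Tl u1; clear; lia.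
    by rewrite /B /= in_itv /= -TE' /=; apply/andP.
move=> h; apply: (le_trans h); apply: (@le_trans _ _ (\sum_(c < k n * q n) (a%:R^-1 + a%:R^-1)%:E)%E).
  apply: lee_sum => c _; rewrite EFinD.
  apply: le_trans (measureU2 (circle_measure R) (mA c) (mB c)) _.
  exact: leeD (hA c) (hB c).
rewrite sumEFin sumr_const card_ord lee_fin -mulr_natr /a !natrM.
have kR : (k n)%:R != 0 :> R by rewrite pnatr_eq0; have := k2 n; clear; lia.
have lR : (l n)%:R != 0 :> R by rewrite pnatr_eq0; have := l0 n; clear; lia.
have qR' : qR n != 0 by rewrite gt_eqF.
rewrite [leLHS](_ : _ = 2 / (l n)%:R) //; field.
by rewrite kR lR qR'.
Qed.

Lemma outer_limsup0 : circle_measure R (lim_sup_set outer) = 0%E.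
Proof.
apply: lim_sup_set_cvg0; first exact: measurable_outer.
apply: (@le_lt_trans _ _ (\sum_(0 <= n <oo) (2%:E * ((l n)%:R^-1)%:E))%E).
  by apply: lee_nneseries => // n _; rewrite -EFinM; exact: outer_le.
rewrite nneseriesZl; last by move=> n _; rewrite lee_fin invr_ge0.
rewrite lte_mul_pinfty // ge0_fin_numE //.
Qed.

Lemma generic_full : (circle_measure R).-negligible (~` generic).
Proof.
apply: (@negligibleS _ _ _ _ (~` U `|` (range ratr `|` lim_sup_set outer))).
  move=> th ng; have [Uth|] := pselect (U th); [right|by left].
  have [[r _ rE]|nr] := pselect ((range ratr : set R) th); first by left; exists r.
  right=> n _; apply: contrapT => h; apply: ng; have [t0 t1] := Uth; split=> //.
    by move=> r rE; apply: nr; exists r.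
  exists n => m nm; apply: contrapT => ni; apply: h.
  by exists m => //; split.
have mrat : measurable (range ratr : set mR).
  apply: countable_measurable => //; apply: card_le_trans (card_image_le _ _) _.
  exact: countableP.
have rat0 : circle_measure R (range ratr) = 0%E.
  apply/eqP; rewrite eq_le measure_ge0 andbT.
  rewrite circle_measureE -(lebesgue_measure_rat R); apply: le_measure; rewrite ?inE.
  - by apply: measurableI; [exact: mrat|exact: measurable_unit_interval].
  - exact: mrat.
  - exact: subIsetl.
apply: negligibleU; last apply: negligibleU.
- exact: negligible_unitC.
- by apply/negligibleP.
- apply/negligibleP; last exact: outer_limsup0.
  apply: bigcapT_measurable => n; apply: bigcup_measurable => j _; exact: measurable_outer.
Qed.

Lemma orbit_generic_full : circle_measure R (~` orbit_generic) = 0%E.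
Proof.
have mog := measurable_orbit_generic.
apply/(@negligibleP _ _ _ (circle_measure R)); first exact: measurableC.
pose F n : set mR := if unpickle n is Some a then
   rotation ((a : int)%:~R * alpha) @^-1` (~` generic) else set0.
apply: (@negligibleS _ _ _ _ (~` U `|` \bigcup_n F n)).
  move=> th ng; have [Uth|] := pselect (U th); [right|by left].
  apply: contrapT => h; apply: ng; have [t0 t1] := Uth; split=> // a.
  apply: contrapT => ng; apply: h; exists (pickle a) => //.
  by rewrite /F pickleK.
apply: negligibleU; first exact: negligible_unitC.
apply: negligible_bigcup => n; rewrite /F; case: unpickle => [a|]; last exact: negligible_set0.
have mg : measurable (~` generic : set mR) by apply: measurableC; exact: measurable_generic.
apply/negligibleP.
  rewrite -[X in measurable X]setTI; exact: (@measurable_rotation R _ measurableT).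
transitivity (circle_measure R (~` generic)); first exact: circle_measure_rotation.
by apply/(@negligibleP _ _ _ (circle_measure R)) => //; exact: generic_full.
Qed.

End GenericPoints.

(** * Recovering the point from its itinerary *)

Variable N : nat.
Hypothesis N2 : (2 <= N)%N.
Hypothesis l2 : forall n, (N <= n)%N -> (2 <= l n)%N.

Lemma lead_b_homo m n : (N <= m)%N -> (m < n)%N -> ((lead_b m).+1 < lead_b n)%N.
Proof.
move=> Nm; elim: n => // n IH; rewrite ltnS leq_eqVlt => /orP[/eqP <-|mn].
  rewrite lead_bS ?l2 //; last exact: leq_trans Nm.
  by have := @coef_q_gt1 m; lia.
have Nn : (N <= n)%N by lia.
by apply: leq_trans (IH mn) _; rewrite lead_bS ?l2 //; lia.
Qed.

(** Induction on [m] by [mark_cell]: at a junction the length of the run forces the level to be n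
    and [J] to be [(q n).-1]; inside a copy of higher level the mark is again a mark of that
    copy. *)
Lemma mark_position n m s : (N < n)%N -> (n < m)%N -> mark n m s ->
  lv m s n = (q n).-1.
Proof.
move=> Nn; elim: m s => // m IH s; rewrite ltnS leq_eqVlt => nm mk.
have Nm : (N < m)%N by case/orP: nm => [/eqP <- //|]; lia.
have m2 : (2 <= m)%N by lia.
have lm : (2 <= l m)%N by apply: l2; lia.
have q0 := coef_q_gt0 m; have sq : (s < q m.+1)%N by case: mk; lia.
have hl := lead_b_lt m2.
have [[B [Bk sE hE]]|[nb pq]] := mark_cell m2 lm mk.
  have jq := J_lt m (B %/ k m).
  case/orP: nm => [/eqP nm|nm]; last by have := @lead_b_homo n m; lia.
  subst m; rewrite lv_S // lv_id /descend sE -[(B * (l n * q n))%N]addn0.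
  rewrite cell_offE ?lq_gt0 // cell_rowE ?lq_gt0 // add0n.
  have -> : J n (B %/ k n) = (q n).-1 by lia.
  by rewrite modn_small // prednK // coef_q_gt0.
have [B [c [Bk cl sE]]] := copyP sq nb; have pl := descend_lt m s.
case: mk => s0 sh He Hb Hnb.
have copy a : (descend m s + a < q m)%N -> W m.+1 (s + a) = W m (descend m s + a).
  move=> aq; have [_ _ _ <-] := copy_pos Bk cl aq; congr nth.
  by rewrite addnA -sE.
case/orP: nm => [/eqP nm|nm].
  (* Inside a copy of w_n the run would be longer than the initial one, against [no_long_b_run]. *)
  subst m; move: Nn Hb copy pq; case: (n) => // n' Nn Hb copy pq.
  have [|||a ah []] := @no_long_b_run n' (descend n'.+1 s); rewrite ?l2 //; try lia.
  by rewrite -copy ?Hb //; lia.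
have hh := lead_b_homo (ltnW Nn) nm.
(* At the start of w_m the run would not end after [lead_b n + 1] letters, since [lead_b m] is
   larger. *)
have p0 : (0 < descend m s)%N.
  rewrite lt0n; apply/eqP => p0; apply: Hnb; rewrite copy ?p0 ?add0n ?W_before_lead_b //; lia.
rewrite lv_S ?(ltnW nm) //; apply: IH => //; split=> //.
- by lia.
- have ps : ((descend m s).-1 < q m)%N by lia.
  have [_ _ _ <-] := copy_pos Bk cl ps; rewrite -He; congr nth.
  by rewrite [in RHS]sE; lia.
- by move=> a ah; rewrite -copy ?Hb //; lia.
- by rewrite -copy //; lia.
Qed.

(** The row with [J n i = (q n).-1] has two adjacent cells because [2 <= k n]; around their junction
    the word reads e^(q_n - 1) b w_n. *)
Lemma mark_exists n : (N < n)%N -> exists s, mark n n.+1 s.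
Proof.
move=> Nn; have n2 : (2 <= n)%N by lia.
have ln : (2 <= l n)%N by apply: l2; lia.
have q1 := @coef_q_gt1 n; have hl := lead_b_lt n2; have kn := k2 n.
pose i := ((p n * (q n).-1) %% q n)%N.
have iq : (i < q n)%N by rewrite ltn_pmod //; lia.
have Ji : J n i = (q n).-1.
  by apply: J_uniq; [lia | rewrite /i modn_mod].
pose B := (i * k n)%N; have B1 : (B.+1 < k n * q n)%N by rewrite /B; nia.
have R0 : (B %/ k n)%N = i by rewrite /B mulnK //; lia.
have R1 : (B.+1 %/ k n)%N = i.
  by rewrite /B -addn1 divnMDl ?(divn_small kn) ?addn0 //; lia.
have lq := lq_gt0 n.
have lq2 : (2 * q n <= l n * q n)%N by rewrite leq_mul2r ln orbT.
have copy a : (a < q n)%N -> W n.+1 (B.+1 * (l n * q n) + a.+1) = W n a.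
  move=> an; have [_ _ _ <-] := @copy_pos n B.+1 0 a B1 ln an.
  rewrite R1 Ji mul0n addn0; congr nth; lia.
have qE : q n.+1 = (k n * q n * (l n * q n))%N := coef_qE n.
have Bq : (B.+2 * (l n * q n) <= q n.+1)%N by rewrite qE leq_mul.
exists (B.+1 * (l n * q n))%N; split.
- by rewrite muln_gt0.
- by move: Bq; rewrite (mulSn B.+1); lia.
- have -> : (B.+1 * (l n * q n)).-1 = (B * (l n * q n) + (l n * q n - 1))%N by rewrite mulSn; lia.
  by apply: W_last_part; rewrite ?R0 ?Ji; lia.
- case=> [|a] ah; first by rewrite W_first_part // R1 Ji; lia.
  by rewrite copy ?W_before_lead_b //; lia.
- by rewrite copy //; apply: W_lead_b.
Qed.

(** A mark lies over position q_n - 1 of w_n, whose arc starts at (q_n - 1) alpha_n, that is, at -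
    alpha_n modulo 1. *)
Lemma mark_near n m c : (N < n)%N -> (n < m)%N -> mark n m c ->
  cnear (c%:R * al m) (- al n) (qR n)^-1.
Proof.
move=> Nn nm mk; have cq : (c < q m)%N by case: mk => _ + _ _ _; clear; lia.
have [t0 t1 lt tn] := word_pointP cq.
have := mark_position Nn nm mk.
rewrite -{1}lt lv_lev //; last exact: ltnW.
move=> e; have := lev_near n t0; rewrite e => nr.
have := cnear_trans (cnear_sym tn) nr; rewrite add0r => nr1.
by have := cnear_trans nr1 (cnear_last_position n); rewrite addr0.
Qed.

Lemma parsed_near x m s M n a : parsed x m s M -> (`|a| + lead_b n < M)%N ->
  has_mark x n a -> (N < n)%N -> (n < m)%N ->
  cnear (s%:R * al m + a%:~R * al m) (- al n) (qR n)^-1.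
Proof.
move=> P aM mk Nn nm; have [c [cE mc]] := parsed_mark P aM mk.
have := mark_near Nn nm mc.
suff -> : s%:R * al m + a%:~R * al m = c%:R * al m by [].
by rewrite -mulrDl; congr (_ * _); rewrite [in RHS]pmulrn cE intrD -pmulrn.
Qed.

(** The point approached involves neither [m] nor [s]: a mark of [x] alone locates index 0 in every
    parse that is long enough. *)
Lemma mark_near_word (x : symZ) n a (e : R) : K x -> has_mark x n a -> (N < n)%N -> 0 < e ->
  exists M m0, forall m s, (m0 <= m)%N -> parsed x m s M ->
    cnear (s%:R * al m) (- al n - a%:~R * alpha) ((qR n)^-1 + e).
Proof.
move=> Kx mk Nn e0; have [m0 hm] := alpha_approx a e0.
exists (`|a| + lead_b n).+1, (maxn m0 n.+1) => m s; rewrite geq_max => /andP[mm nm] P.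
have c1 : cnear (s%:R * al m + a%:~R * alpha) (s%:R * al m + a%:~R * al m) e.
  apply: cnear_le (hm m mm) _.
  rewrite (_ : a%:~R * (alpha - al m) =
     (s%:R * al m + a%:~R * alpha) - (s%:R * al m + a%:~R * al m)); last by ring.
  exact: cnear_norm.
apply: cnear_shift; rewrite [(qR n)^-1 + e]addrC.
exact: cnear_trans c1 (parsed_near P (ltnSn _) mk Nn nm).
Qed.

(** Both points are compared with the position of index 0 in one word that contains both marks. *)
Lemma mark_compat (x : symZ) n a n' a' : K x -> (N < n)%N -> (N < n')%N ->
  has_mark x n a -> has_mark x n' a' ->
  cnear (- al n - a%:~R * alpha) (- al n' - a'%:~R * alpha) (2 / qR n + 2 / qR n').
Proof.
move=> Kx Nn Nn' mk mk'; have V m : 0 < (qR m)^-1 by rewrite invr_gt0.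
have [M [m0 h]] := mark_near_word Kx mk Nn (V n).
have [M' [m0' h']] := mark_near_word Kx mk' Nn' (V n').
have [m [s [mm P]]] := circle_factor_parsed_above (maxn M M') (maxn m0 m0') Kx.
move: mm; rewrite gtn_max => /andP[/ltnW m1 /ltnW m2].
have nr := h m s m1 (parsed_le (leq_maxl _ _) P).
have nr' := h' m s m2 (parsed_le (leq_maxr _ _) P).
have := cnear_trans (cnear_sym nr) nr'.
by apply: cnear_le; lra.
Qed.

(* The bound 1 / q_n also holds; 5 / q_n leaves room for the limit in
   [marks_exists]. *)
Definition marks (x : symZ) (th : R) := forall n a, (N < n)%N -> has_mark x n a ->
  cnear (th + a%:~R * alpha) (- al n) (5 / qR n).

Definition marked : set symZ := [set x | K x /\ forall n0, exists n a,
  [/\ (n0 <= n)%N, (N < n)%N & has_mark x n a]].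

(** Compactness: each mark proposes a point, and the proposals of marks of growing level have a
    cluster point. *)
Lemma marks_exists x : marked x -> exists th, [/\ 0 <= th, th < 1 & marks x th].
Proof.
move=> [Kx mx].
have /choice[f hf] : forall i : nat, exists na : nat * int,
    [/\ (i <= na.1)%N, (N < na.1)%N & has_mark x na.1 na.2].
  by move=> i; have [n [a h]] := mx i; exists (n, a).
pose c i : R := - al (f i).1 - (f i).2%:~R * alpha.
pose u i := rotation 0 (c i).
have [|g gi gc] := @bolzano_weierstrass R u.
  exists 1; split; first exact: real1.
  move=> M M1 i _ /=; rewrite ger0_norm ?rotation_ge0 //.
  exact: ltW (lt_trans (rotation_lt1 _ _) M1).
pose z := lim ((u \o g) @ \oo).
(* The limit of points of [[0, 1[] may be 1, hence the reduction modulo 1. *)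
exists (rotation 0 z); split; rewrite ?rotation_ge0 ?rotation_lt1 //.
move=> n a Nn mk; apply/cnear_sym.
have V m : 0 < (qR m)^-1 by rewrite invr_gt0.
have : \forall i \near \oo, `|z - u (g i)| < (qR n)^-1.
  by move/cvgrPdist_lt: gc; apply.
move=> [i0 _ hi]; pose i := maxn i0 n.
have gi' : forall j, (j <= g j)%N.
  elim=> // j IH; apply: leq_ltn_trans IH _.
  by have := gi j.+1 j; rewrite ltnn ltnNge => /negbT.
have h1 := hi i (leq_maxl _ _).
have [f1 f2 f3] := hf (g i).
have qq : (qR (f (g i)).1)^-1 <= (qR n)^-1.
  rewrite lef_pV2 ?posrE // ler_nat; apply: coef_q_homo => //.
  exact: leq_trans (leq_maxr i0 n) (leq_trans (gi' i) f1).
have c1 := mark_compat Kx Nn f2 mk f3; rewrite -/(c (g i)) in c1.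
have c2 : cnear (c (g i)) (u (g i)) 0.
  by apply: cnear_sym; have := cnear_rotation 0 (c (g i)); rewrite addr0.
have c3 : cnear (u (g i)) z (qR n)^-1.
  by apply: cnear_le (ltW h1) _; rewrite distrC; apply: cnear_norm.
have c4 : cnear z (rotation 0 z) 0.
  by apply: cnear_sym; have := cnear_rotation 0 z; rewrite addr0.
(* The errors 2 / q_n, 2 / q_(n') <= 2 / q_n and 1 / q_n add up to 5 / q_n. *)
have := cnear_trans (cnear_trans (cnear_trans c1 c2) c3) c4.
move=> /(cnearD (a%:~R * alpha)); rewrite subrK.
by apply: cnear_le; move: qq; set v := (qR n)^-1; set w := (qR _)^-1; lra.
Qed.

Lemma marks_uniq x th th' : marked x -> 0 <= th -> th < 1 -> 0 <= th' -> th' < 1 ->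
  marks x th -> marks x th' -> th = th'.
Proof.
move=> [_ mx] t0 t1 t0' t1' h h'; apply: cnear_eq => // e e0.
have [n0 hn] := qRV_small 10 e0.
have [n [a [nn Nn mk]]] := mx n0.
have := cnear_trans (h n a Nn mk) (cnear_sym (h' n a Nn mk)).
move=> /(cnearD (- (a%:~R * alpha))); rewrite !addrK.
by apply: cnear_le; have := hn n nn; lra.
Qed.

(** With [marked x] inside the set, every unmarked sequence gets the value 0, on which measurability
    relies. *)
Definition angle (x : symZ) : R :=
  xget 0 [set th | [/\ marked x, 0 <= th, th < 1 & marks x th]].

Lemma angleP x : marked x -> [/\ 0 <= angle x, angle x < 1 & marks x (angle x)].
Proof.
move=> mx; have [th [t0 t1 mt]] := marks_exists mx.
rewrite /angle; case: xgetP => [y -> [] //|/(_ th)].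
by case.
Qed.

Lemma angle_uniq x th : marked x -> 0 <= th -> th < 1 -> marks x th -> angle x = th.
Proof.
by move=> mx t0 t1 mt; have [d0 d1 md] := angleP mx; apply: (marks_uniq mx).
Qed.

Lemma marked_shift b (x : symZ) : marked x -> marked (shiftz b x).
Proof.
move=> [Kx mx]; split; first exact: circle_factor_shift.
move=> n0; have [n [a [h1 h2 h3]]] := mx n0; exists n, (a - b); split=> //.
by apply/has_mark_shift; rewrite subrK.
Qed.

Lemma angle_shift b (x : symZ) : marked x ->
  angle (shiftz b x) = rotation (b%:~R * alpha) (angle x).
Proof.
move=> mx; have [d0 d1 md] := angleP mx.
apply: angle_uniq; rewrite ?rotation_ge0 ?rotation_lt1 //; first exact: marked_shift.
move=> n a Nn /has_mark_shift mk; have := md n (a + b) Nn mk.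
have := cnearD (a%:~R * alpha) (cnear_rotation (b%:~R * alpha) (angle x)).
rewrite (_ : angle x + b%:~R * alpha + a%:~R * alpha = angle x + (a + b)%:~R * alpha); last by rewrite intrD; ring.
move=> c1 c2.
by have := cnear_trans c1 c2; rewrite add0r.
Qed.

(** Index 0 lies in a full copy of w_(n+1), which contains a mark by [mark_exists]. *)
Lemma parsed_copy_mark x m s M n : parsed x m s M -> (q n.+1 <= M)%N -> (n.+1 <= m)%N ->
  (N < n)%N -> (forall n', (n.+1 <= n' < m)%N -> ~~ bdry n' (lv m s n'.+1)) ->
  exists a, has_mark x n a.
Proof.
move=> [sq P] qM nm Nn nb; have [ls h] := lv_copy nm sq nb.
have lq := lv_lt nm sq; set v := lv _ _ _ in ls h lq.
have [c [c0 cq ce cb cn]] := mark_exists Nn.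
have at_ i : (i < q n.+1)%N -> x (i%:Z - v%:Z) = W n.+1 i.
  move=> iq; have [|d [dE dq ->]] := P (i%:Z - v%:Z); first by clear -iq lq qM; lia.
  have [_ <- _] := h i iq; congr nth; clear -dE ls; lia.
exists (c%:Z - v%:Z); split.
- rewrite -ce -at_; first by congr x; clear -c0; lia.
  by clear -cq c0; lia.
- move=> i il; rewrite -(cb i il) -at_; first by congr x; clear; lia.
  by clear -cq il; lia.
- rewrite (_ : _ + _ = (c + (lead_b n).+1)%N%:Z - v%:Z); last by clear; lia.
  by rewrite at_.
Qed.

Lemma coding_marked th : orbit_generic th -> marked (coding th).
Proof.
move=> og; have [h0 h1 _ [n0 inn]] := orbit_generic_generic og; split.
  apply/circle_factorP => M; have [n1 hn1] := coding_parsed M og.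
  by exists n1, (lev n1 th); apply: hn1.
move=> n2; pose n := (maxn n0 (maxn n2 N)).+1.
have [n1 hn1] := coding_parsed (q n.+1) og.
pose m := maxn n1 n.+1.
have nn0 : (n0 <= n)%N by rewrite /n; clear; lia.
have [|||||a ha] := @parsed_copy_mark (coding th) m (lev m th) (q n.+1) n.
- by apply: hn1; apply: leq_maxl.
- by [].
- exact: leq_maxr.
- by rewrite /n; clear; lia.
- move=> n' /andP[nn' n'm]; rewrite lv_lev //.
  by have [|] := inner_lev h0 h1 (inn n' _); first by clear -nn0 nn'; lia.
by exists n, a; split=> //; rewrite /n; clear; lia.
Qed.

Lemma coding_marks th : orbit_generic th -> marks (coding th) th.
Proof.
move=> og n a Nn mk; have [h0 h1 _ _] := orbit_generic_generic og.
have [n1 hn1] := coding_parsed (`|a| + lead_b n).+1 og.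
have [_ _ /(_ a)[g0 g1 _ [n2 inn2]]] := og.
have [_ _ _ [n3 inn3]] := orbit_generic_generic og.
pose m := maxn n1 (maxn n3 (maxn n.+1 (2 * `|a|)%N)).
have P := hn1 m (leq_maxl _ _).
have [c [cE mc]] := parsed_mark P (ltnSn _) mk.
have nm : (n < m)%N by rewrite /m; clear; lia.
have cq : (c < q m)%N by case: mc => _ + _ _ _; clear; lia.
have lc : lev m (rotation (a%:~R * alpha) th) = c.
  apply: lev_shift => //; first by apply: inn3; rewrite /m; clear; lia.
  by apply: leq_trans (ltnW (ltn_coef_q m)); rewrite /m; clear; lia.
have := mark_position Nn nm mc; rewrite -lc lv_lev ?(ltnW nm) // => ln.
have := lev_near n g0; rewrite ln => nr.
have := cnear_trans (cnear_trans (cnear_sym (cnear_rotation (a%:~R * alpha) th)) nr)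
  (cnear_last_position n).
apply: cnear_le; rewrite add0r addr0.
have v0 : 0 < (qR n)^-1 by rewrite invr_gt0.
by move: v0; lra.
Qed.

Lemma coding_angle th : orbit_generic th -> angle (coding th) = th.
Proof.
move=> og; have [h0 h1 _ _] := orbit_generic_generic og.
by apply: angle_uniq => //; [exact: coding_marked|exact: coding_marks].
Qed.

(** * Sequences whose index 0 is interior at all high levels *)

Definition two_sided (x : bisequence) :=
  (exists i : int, i < 0 /\ ~~ okz x i) /\ (exists i : int, 0 <= i /\ ~~ okz x i).

(** A boundary letter of high level lies in an admissible stretch longer than 2 A. Around index 0
    such a stretch covers all transitions up to distance A on one side, including a forbidden
    one. *)
Lemma two_sided_inner x : two_sided x -> exists n2 A, forall m s M, (A <= M)%N ->
  parsed x m s M -> forall n, (n2 <= n < m)%N -> ~~ bdry n (lv m s n.+1).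
Proof.
move=> [[i1 [i1n ok1]] [i2 [i2p ok2]]]; pose A := (`|i1| + `|i2|).+1.
exists (2 * A + 3)%N, A => m s M AM [sq P] n nn; apply/negP => bd.
pose bad n := (n < m)%N && bdry n (lv m s n.+1).
have exbad : exists n', bad n' by exists n; rewrite /bad bd andbT; case/andP: nn.
have ub n' : bad n' -> (n' <= m)%N by case/andP => /ltnW.
(* Above the highest bad level there is no boundary, so [lv_copy] carries the word of level n' + 1,
   with its stretch, over to [x]. *)
case: (ex_maxnP exbad ub) => n' /andP[n'm bd'] max.
have nn' : (2 * A + 3 <= n')%N.
  by apply: (leq_trans (proj1 (andP nn))); apply: max; rewrite /bad bd andbT; case/andP: nn.
have [|ls h] := lv_copy n'm sq.
  move=> n3 /andP[a1 a2]; apply/negP => bd3.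
  by have := max n3; rewrite /bad a2 bd3 => /(_ isT); rewrite leqNgt a1.
have lq := lv_lt n'm sq; set v := lv _ _ _ in ls h lq bd'.
have [|u [w [uvw wq puw ok]]] := bdry_run _ lq bd'; first by clear -nn'; lia.
have at_ (i : int) (c : nat) : c%:Z = v%:Z + i -> (c < q n'.+1)%N -> (`|i| <= A)%N -> x i = W n'.+1 c.
  move=> cE cq iA; have [|d [dE dq ->]] := P i; first exact: leq_trans AM.
  by have [_ <- _] := h c cq; congr nth; clear -cE dE ls; lia.
have both (i : int) (c : nat) : c%:Z = v%:Z + i -> (`|i| < A)%N -> (u <= c)%N -> (c.+1 < w)%N -> okz x i.
  move=> cE iA uc cw; rewrite /okz (at_ i c) ?(at_ (i + 1) c.+1) ?ok //.
  - by clear -cE; lia.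
  - by clear -cw wq; lia.
  - by clear -iA; lia.
  - by clear -cw wq; lia.
  - by clear -iA; lia.
have big : (2 * A < w - u)%N.
  apply: leq_trans puw; have n'2 : (2 <= n')%N by clear -nn'; lia.
  have := coef_p_gt n'2; have := ltn_coef_q n'.-1.
  by clear -nn'; lia.
case: (leqP (u + A) v) => uv.
  have e : (absz (v%:Z + i1))%:Z = v%:Z + i1 by apply: gez0_abs; clear -uv i1n; rewrite /A in uv; lia.
  move/negP: ok1; apply; apply: (both i1 (absz (v%:Z + i1))) => //.
  - by clear; rewrite /A; lia.
  - by move: e; set z := absz (v%:Z + i1); clear -uv; rewrite /A in uv; lia.
  - by move: e; set z := absz (v%:Z + i1); clear -uvw i1n; lia.
have e : (absz (v%:Z + i2))%:Z = v%:Z + i2 by apply: gez0_abs; clear -i2p; lia.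
move/negP: ok2; apply; apply: (both i2 (absz (v%:Z + i2))) => //.
- by clear; rewrite /A; lia.
- by move: e; set z := absz (v%:Z + i2); clear -uvw i2p; lia.
- by move: e; set z := absz (v%:Z + i2); clear -uv big uvw i2p; rewrite /A in uv big; lia.
Qed.

Lemma two_sided_marked (x : symZ) : K x -> two_sided x -> marked x.
Proof.
move=> Kx /two_sided_inner[n2 [A H]]; split=> // n0.
pose n := (maxn n0 (maxn n2 N)).+1.
have [m [s [nm P]]] := circle_factor_parsed_above (maxn A (q n.+1)) n.+1 Kx.
have [|||||a ha] := @parsed_copy_mark x m s (maxn A (q n.+1)) n.
- by [].
- exact: leq_maxr.
- exact: ltnW.
- by rewrite /n; clear; lia.
- move=> n' /andP[nn' n'm]; apply: H P _ _; first exact: leq_maxl.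
  by rewrite n'm andbT; apply: leq_trans nn'; rewrite /n; clear; lia.
by exists n, a; split=> //; rewrite /n; clear; lia.
Qed.

(** The angle is irrational, hence interior to its level-n arc, so the point under index 0 in a long
    parse lies in the same arc. Neither point meets a boundary above level n: [x 0] and the limit
    letter are both the letter of w_n over this arc. *)
Lemma recover (x : symZ) : K x -> two_sided x -> generic (angle x) ->
  x 0 = limit_sym (angle x).
Proof.
move=> Kx tx [t0 t1 irr [n0 inn]]; set th := angle x in t0 t1 irr inn *.
have mx := two_sided_marked Kx tx.
have [_ _ md] := angleP mx; rewrite -/th in md.
have [n2 [A H]] := two_sided_inner tx.
pose n := maxn n0 n2.
have nn0 : (n0 <= n)%N := leq_maxl _ _; have nn2 : (n2 <= n)%N := leq_maxr _ _.
rewrite (limit_sym_inner t0 t1 inn nn0).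
have q0 := qR_gt0 n.
have /truncn_itv/andP[b1 b2] : 0 <= qR n * th by rewrite mulr_ge0 // ltW.
have tq := truncn_qR_lt n t0 t1.
set t := Num.truncn _ in b1 b2 tq.
have {}b1 : t%:R < qR n * th.
  rewrite lt_neqAle b1 andbT; apply/eqP => e; apply: (irr (t%:R / (q n)%:R)).
  by rewrite rmorphM fmorphV !rmorph_nat e mulrC mulKf // gt_eqF.
rewrite -addn1 natrD in b2.
(* [d / q n] is the distance from [th] to the ends of its arc; [e] below is half of it. *)
pose d := Num.min (qR n * th - t%:R) (t%:R + 1 - qR n * th).
have d0 : 0 < d by rewrite lt_min; apply/andP; split; lra.
have d1 : d <= qR n * th - t%:R by rewrite ge_min lexx.
have d2 : d <= t%:R + 1 - qR n * th by rewrite ge_min lexx orbT.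
pose e := d / qR n / 2.
have e0 : 0 < e by rewrite !divr_gt0.
have eE : 2 * (qR n * e) = d by rewrite /e; field; rewrite gt_eqF.
(* The errors 1 / q_(n') + e / 2 and 5 / q_(n') stay within e once 12 / q_(n') <= e. *)
have [n1 hn1] := qRV_small 12 e0.
have [n' [a [nn' Nn' mk]]] := mx.2 n1.
have e2 : 0 < e / 2 by rewrite divr_gt0.
have [M [m0 near]] := mark_near_word Kx mk Nn' e2.
have [m [s [mm P]]] := circle_factor_parsed_above (maxn A M) (maxn m0 n) Kx.
move: mm; rewrite gtn_max => /andP[/ltnW mm0 /ltnW nm].
have sq := P.1.
have c1 := near m s mm0 (parsed_le (leq_maxr _ _) P).
have c2 := cnear_shift (md n' a Nn' mk).
have [w0 w1 ws wn] := word_pointP sq.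
set th' := word_point m s in w0 w1 ws wn.
have c3 : cnear th' th e.
  have := cnear_trans wn (cnear_trans c1 (cnear_sym c2)); apply: cnear_le.
  by have := hn1 n' nn'; set v := (qR n')^-1; lra.
have tq' : t%:R + 1 <= qR n by rewrite -natr1 || rewrite -(natrD _ t 1) ler_nat addn1.
have te : e <= th /\ th < 1 - e.
  have tp : 0 <= (t%:R : R) by [].
  split; first by rewrite -(ler_pM2l q0); lra.
  by rewrite -(ltr_pM2l q0) mulrBr; lra.
have {c3} : `|th' - th| <= e.
  by case: (cnear_real w0 w1 te.1 (ltW te.2) c3) => // -[_ h]; have := te.2; rewrite h ltxx.
rewrite ler_norml => /andP[r1 r2].
have r1' : - (qR n * e) <= qR n * th' - qR n * th by rewrite -mulrBr -mulrN ler_pM2l.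
have r2' : qR n * th' - qR n * th <= qR n * e by rewrite -mulrBr ler_pM2l.
have trE : Num.truncn (qR n * th') = t.
  by apply: truncn_def; rewrite -addn1 natrD; apply/andP; split; lra.
have <- : lev n th' = lev n th by rewrite /lev trE.
rewrite -(lv_lev w0 w1 nm) ws -lv_letter //; last first.
  move=> n'' /andP[a1 a2]; apply: H P _ _; first exact: leq_maxl.
  by rewrite a2 (leq_trans nn2 a1).
by have [|c [cE _ ->]] := P.2 0 => //; congr nth; move: cE; clear; lia.
Qed.

(** * Measurability of the angle *)

Definition mark_point n (a : int) : R := rotation (- (a%:~R * alpha)) (- al n).

Lemma angle_unmarked x : ~ marked x -> angle x = 0.
Proof. by move=> nm; rewrite /angle; case: xgetP => // y _ []. Qed.

(** A mark locates the angle up to 5 / q_n, so one of countably many marks witnesses the inequality;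
    the upper bound on [mark_point] excludes passing through 1. *)
Lemma angle_gtP u x : 0 <= u -> (u < angle x) <->
  (marked x /\ exists n a, [/\ (N < n)%N, has_mark x n a,
     u + 5 / qR n < mark_point n a & mark_point n a < 1 - 5 / qR n]).
Proof.
move=> u0; have V n : 0 < 5 / qR n by rewrite divr_gt0.
have near n a : marked x -> (N < n)%N -> has_mark x n a ->
    cnear (angle x) (mark_point n a) (5 / qR n).
  move=> mx Nn mk; have [_ _ md] := angleP mx.
  have := cnear_trans (cnear_shift (md n a Nn mk))
    (cnear_sym (cnear_rotation (- (a%:~R * alpha)) (- al n))).
  by rewrite addr0.
split=> [ud|[mx [n [a [Nn mk h1 h2]]]]].
  have mx : marked x.
    by apply: contrapT => /angle_unmarked d0; move: ud; rewrite d0 ltNge u0.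
  split=> //; have [d0 d1 _] := angleP mx.
  pose e := Num.min (angle x - u) (1 - angle x).
  have e0 : 0 < e / 3 by rewrite divr_gt0 // lt_min !subr_gt0 ud d1.
  have ea : e <= angle x - u by rewrite ge_min lexx.
  have eb : e <= 1 - angle x by rewrite ge_min lexx orbT.
  have [n0 hn0] := qRV_small 5 e0; have [n [a [nn Nn mk]]] := mx.2 n0.
  have v := hn0 n nn; have v0 := V n; exists n, a.
  have c := cnear_sym (near n a mx Nn mk).
  have : `|mark_point n a - angle x| <= 5 / qR n.
    case: (cnear_real _ _ _ _ c) => //; rewrite ?rotation_ge0 ?rotation_lt1 //.
    - by move: v v0; lra.
    - by move: v v0; lra.
    - by move=> [_ h]; move: v v0; lra.
  rewrite ler_norml => /andP[r1 r2].
  by split=> //; move: v v0 r1 r2; lra.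
have [d0 d1 _] := angleP mx; have v0 := V n.
case: (cnear_real d0 d1 _ _ (near n a mx Nn mk)).
- by move: v0; lra.
- by exact: ltW.
- by rewrite ler_norml => /andP[r1 r2]; move: v0 r1 r2; lra.
- by move=> [_ h]; move: h2; rewrite h ltxx.
Qed.

Lemma measurable_marked : measurable marked.
Proof.
apply: measurable_conj; first exact: measurable_circle_factor.
apply: measurable_all => n0; apply: measurable_ex => n; apply: measurable_ex => a.
rewrite [X in measurable X](_ : _ = [set x : symZ | ((n0 <= n)%N /\ (N < n)%N) /\ has_mark x n a]).
  by apply: measurable_conj; [exact: measurable_prop|exact: measurable_has_mark].
by apply/seteqP; split=> x /=; [move=> []|move=> [[]]].
Qed.

Lemma measurable_angle : measurable_fun setT (angle : symZ -> R).
Proof.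
apply: (@measurability _ _ symZ (measurableTypeR R) setT angle (@RGenOInfty.G R)); first exact: RGenOInfty.measurableE.
move=> _ [_ [u ->] <-]; rewrite setTI.
have [u0|u0] := ltP u 0.
  rewrite (_ : _ @^-1` _ = setT) //; apply/seteqP; split=> // x _ /=.
  rewrite in_itv /= andbT; apply: lt_le_trans u0 _.
  have [mx|/angle_unmarked ->] := pselect (marked x); last by [].
  by have [] := angleP mx.
rewrite (_ : _ @^-1` _ = [set x | marked x /\ exists n a, ((N < n)%N /\ 
     u + 5 / qR n < mark_point n a /\ mark_point n a < 1 - 5 / qR n) /\ has_mark x n a]).
  apply: measurable_conj; first exact: measurable_marked.
  apply: measurable_ex => n; apply: measurable_ex => a.
  by apply: measurable_conj; [exact: measurable_prop|exact: measurable_has_mark].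
apply/seteqP; split=> x /=; rewrite in_itv /= andbT.
  move/(angle_gtP x u0) => [mx [n [a [h1 h2 h3 h4]]]].
  by split=> //; exists n, a.
move=> [mx [n [a [[h1 [h2 h3]] h4]]]]; apply/(angle_gtP x u0).
by split=> //; exists n, a.
Qed.

Hypothesis l_sum : (\sum_(0 <= n <oo) (((l n)%:R : R)^-1)%:E < +oo)%E.

(** * The isomorphism *)

Lemma shE : sh = shiftz 1.
Proof. by []. Qed.

Lemma coding_sh th : coding (rotation alpha th) = sh (coding th).
Proof. by apply: funext => a; have := coding_shift a 1 th; rewrite mul1r. Qed.

Lemma orbit_generic_sh th : orbit_generic th -> orbit_generic (rotation alpha th).
Proof. by move=> /(orbit_generic_rotation 1); rewrite mul1r. Qed.

Lemma angle_sh x : marked x -> angle (sh x) = rotation alpha (angle x).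
Proof. by move=> mx; rewrite shE angle_shift // mul1r. Qed.

Lemma angle_unit x : U (angle x).
Proof.
have [mx|/angle_unmarked ->] := pselect (marked x); last by split.
by have [] := angleP mx; split.
Qed.

Lemma measurable_angleR : measurable_fun (setT : set symZ) (angle : symZ -> mR).
Proof. exact: measurable_angle. Qed.

Lemma measurable_codingR : measurable_fun (setT : set mR) (coding : mR -> symZ).
Proof. exact: measurable_coding. Qed.

Definition coded : set symZ := [set x | (marked x /\ orbit_generic (angle x)) /\
  forall a : int, x a = coding (angle x) a].

Lemma codedE x : coded x -> coding (angle x) = x.
Proof. by move=> [_ h]; apply: funext => a; rewrite h. Qed.

Lemma measurable_coded : measurable coded.
Proof.
have mog : measurable (orbit_generic : set mR) := measurable_orbit_generic.
apply: measurable_conj.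
  apply: measurable_conj; first exact: measurable_marked.
  rewrite -[X in measurable X]setTI; exact: measurable_angleR.
apply: measurable_all => a.
rewrite [X in measurable X](_ : _ = [set x : symZ | exists c, x a = c /\ coding (angle x) a = c]).
  apply: measurable_ex => c; apply: measurable_conj; first exact: measurable_letter.
  have mc : measurable (coding @^-1` [set x : symZ | x a = c] : set mR).
    rewrite -[X in measurable X]setTI; apply: measurable_codingR => //; exact: measurable_letter.
  have := measurable_angleR measurableT mc; rewrite setTI; exact.
apply/seteqP; split=> x /=; first by move=> ->; exists (coding (angle x) a).
by move=> [c [-> ->]].
Qed.

Lemma coded_sh x : coded x -> coded (sh x).
Proof.
move=> [[mx og] h]; split; first split; rewrite ?angle_sh //.
- exact: (@marked_shift 1).
- exact: orbit_generic_sh.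
- by move=> a; rewrite coding_sh /sh h.
Qed.

Lemma coding_coded th : orbit_generic th -> coded (coding th).
Proof.
move=> og; have aE := coding_angle og.
split; first split; rewrite ?aE //; exact: coding_marked.
Qed.

Lemma two_sided_coded (x : symZ) : K x -> orbit_generic (angle x) ->
  (forall a, two_sided (shiftz a x)) -> coded x.
Proof.
move=> Kx og tx; have mx : marked x.
  by apply: (two_sided_marked Kx); have := tx 0; rewrite shiftz0.
split=> // a; have mxa := marked_shift a mx.
have aE := angle_shift a mx.
have := @recover (shiftz a x) (circle_factor_shift a Kx) (tx a); rewrite aE {1}/shiftz add0r; apply.
exact: orbit_generic_generic (orbit_generic_rotation a og).
Qed.

(** * An arbitrary nonatomic invariant measure *)

Section Measure.
Variable nu : {measure set symZ -> \bar R}.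
Hypothesis nuP : nonatomic_shift_invariant_prob K nu.

Let nu1 : nu setT = 1%E. Proof. by case: nuP. Qed.
Let nuK : nu K = 1%E. Proof. by case: nuP. Qed.
Let nu_inv (A : set symZ) : measurable A -> nu (sh @^-1` A) = nu A.
Proof. by case: nuP => _ _ + _; apply. Qed.
Let nu_atomless (x : symZ) : nu [set x] = 0%E.
Proof. by case: nuP => _ _ _; apply. Qed.

Lemma two_sided_full : nu.-negligible (~` [set x | K x /\ forall a, two_sided (shiftz a x)]).
Proof.
pose F n : set symZ := if unpickle n is Some a then left_tail a `|` right_tail a else set0.
apply: (@negligibleS _ _ _ _ (~` K `|` \bigcup_n F n)).
  move=> x nx; have [Kx|] := pselect (K x); [right|by left].
  apply: contrapT => h; apply: nx; split=> // a.
  have nt : ~ (left_tail a `|` right_tail a) x.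
    by move=> hx; apply: h; exists (pickle a) => //; rewrite /F pickleK.
  split; apply: contrapT => hh; apply: nt; [left|right] => i ia.
    apply: contrapT => /negP ok; apply: hh; exists (i - a); split; first by rewrite subr_lt0.
    by rewrite /okz /shiftz subrK addrAC subrK.
  apply: contrapT => /negP ok; apply: hh; exists (i - a); split; first by rewrite subr_ge0.
  by rewrite /okz /shiftz subrK addrAC subrK.
apply: negligibleU.
  apply/negligibleP; first by apply: measurableC; exact: measurable_circle_factor.
  by apply: mu_null_compl => //; exact: measurable_circle_factor.
apply: negligible_bigcup => n; rewrite /F; case: unpickle => [a|]; last exact: negligible_set0.
apply: negligibleU; apply/negligibleP.
- exact: measurable_left_tail.
- exact: nu_left_tail.
- exact: measurable_right_tail.
- exact: nu_right_tail.
Qed.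

Lemma marked_full : nu (~` marked) = 0%E.
Proof.
apply/(@negligibleP _ _ _ nu); first by apply: measurableC; exact: measurable_marked.
apply: negligibleS two_sided_full => x nm [Kx tx]; apply: nm.
by apply: (two_sided_marked Kx); have := tx 0; rewrite shiftz0.
Qed.

Lemma angle_measure (A : set mR) : measurable A -> nu (angle @^-1` A) = circle_measure R A.
Proof.
move=> mA; have mm : measurable marked by exact: measurable_marked.
have l_small := nneseries_term_small (fun n => _ : 0 <= (l n)%:R^-1) l_sum.
apply: (@invariant_unique _ (image_measure nu measurable_angleR)) => //.
- by apply: l_small => n; rewrite invr_ge0.
- rewrite image_measureE (_ : _ @^-1` _ = setT) //.
  by apply/seteqP; split=> // x _; exact: angle_unit.
- move=> B mB; change (nu (angle @^-1` (rotation alpha @^-1` B)) = nu (angle @^-1` B)).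
  have mB1 : measurable (angle @^-1` B) by rewrite -[X in measurable X]setTI; exact: measurable_angleR.
  have mrB : measurable (rotation alpha @^-1` B : set mR).
    by rewrite -[X in measurable X]setTI; exact: (@measurable_rotation R alpha).
  have mB2 : measurable (angle @^-1` (rotation alpha @^-1` B)).
    by rewrite -[X in measurable X]setTI; exact: measurable_angleR.
  have mB3 : measurable (sh @^-1` (angle @^-1` B) : set symZ).
    by rewrite -[X in measurable X]setTI; exact: (@measurable_shiftz 1).
  rewrite -(nu_inv mB1) -(mu_full mm mB2 marked_full) -(mu_full mm mB3 marked_full).
  congr (nu _); apply/seteqP; split=> x /= [h mx]; split=> //; move: h; by rewrite /= angle_sh.
Qed.

Lemma coded_full : nu (~` coded) = 0%E.
Proof.
apply/(@negligibleP _ _ _ nu); first by apply: measurableC; exact: measurable_coded.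
have mog : measurable (~` orbit_generic : set mR).
  by apply: measurableC; exact: (measurable_orbit_generic).
have mN : measurable (angle @^-1` (~` orbit_generic)).
  by rewrite -[X in measurable X]setTI; exact: measurable_angleR.
have N0 : nu (angle @^-1` (~` orbit_generic)) = 0%E.
  by rewrite angle_measure // (orbit_generic_full l_sum).
apply: (@negligibleS _ _ _ _ (angle @^-1` (~` orbit_generic) `|`
   ~` [set x | K x /\ forall a, two_sided (shiftz a x)])).
  move=> x nc; have [og|] := pselect (orbit_generic (angle x)); [right|by left].
  by move=> [Kx tx]; apply: nc; apply: two_sided_coded.
by apply: negligibleU; [apply/negligibleP|exact: two_sided_full].
Qed.

(** The right-hand side does not involve [nu], which yields uniqueness. *)
Lemma coded_measure (A : set symZ) : measurable A -> nu A = circle_measure R (coding @^-1` A).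
Proof.
move=> mA; have mc : measurable coded by exact: measurable_coded.
have mcA : measurable (coding @^-1` A : set mR).
  by rewrite -[X in measurable X]setTI; exact: measurable_codingR.
have macA : measurable (angle @^-1` (coding @^-1` A)).
  by rewrite -[X in measurable X]setTI; exact: measurable_angleR.
rewrite -angle_measure // -(mu_full mc mA coded_full) -(mu_full mc macA coded_full).
by congr (nu _); apply/seteqP; split=> x /= [h cx]; split=> //; move: h; rewrite /= codedE.
Qed.

Lemma circle_factor_isomorphic :
  mt_isomorphic K nu sh U lebesgue_circle (rotation alpha).
Proof.
have mog : measurable (orbit_generic : set mR) := measurable_orbit_generic.
have og0 : circle_measure R (~` orbit_generic) = 0%E := orbit_generic_full l_sum.
exists coded, orbit_generic, angle, coding; split.
- split=> //; first by move=> x [[[]]].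
    by move=> y [].
  exact: measurable_coded.
- by split; [exact: coded_full|exact: og0].
- split; first exact: coded_sh.
  exact: orbit_generic_sh.
- split; [by move=> x [[]]|exact: coding_coded|exact: codedE|].
  by move=> y og; rewrite coding_angle.
- split.
  + exact: measurable_funTS measurable_angleR.
  + exact: measurable_funTS measurable_codingR.
  + move=> B mB; rewrite -[RHS]/(circle_measure R (orbit_generic `&` B)).
    have maB : measurable (angle @^-1` B) by rewrite -[X in measurable X]setTI; exact: measurable_angleR.
    rewrite setIC (mu_full measurable_coded maB coded_full) angle_measure // setIC.
    by rewrite (mu_full mog mB og0).
  + by move=> x [[mx _] _]; exact: angle_sh.
Qed.

End Measure.

Lemma coding_measure_prob :
  nonatomic_shift_invariant_prob K (image_measure (circle_measure R) measurable_codingR).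
Proof.
have mog : measurable (orbit_generic : set mR) := measurable_orbit_generic.
have og0 : circle_measure R (~` orbit_generic) = 0%E := orbit_generic_full l_sum.
have m1 := circle_measure_setT R.
have pre (A : set symZ) : measurable A -> measurable (coding @^-1` A : set mR).
  by move=> mA; rewrite -[X in measurable X]setTI; exact: measurable_codingR.
split.
- by rewrite image_measureE preimage_setT m1.
- have mK : measurable (K : set symZ) by exact: measurable_circle_factor.
  rewrite image_measureE -(mu_full mog (pre _ mK) og0).
  rewrite (_ : _ `&` _ = setT `&` orbit_generic) ?mu_full //.
  apply/seteqP; split=> y [_ og]; split=> //.
  by have [] := coding_marked og.
- move=> A mA; change (circle_measure R (coding @^-1` (sh @^-1` A)) =
    circle_measure R (coding @^-1` A)).
  rewrite -[RHS](circle_measure_rotation alpha); last exact: pre.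
  congr (circle_measure R _); by apply/seteqP; split=> y /=; rewrite coding_sh.
(* On generic orbits [angle] inverts [coding], so the preimage of [x] there is contained in one
   point. *)
- move=> x; rewrite image_measureE -(mu_full mog (pre _ (measurable_symZ1 x)) og0).
  apply/eqP; rewrite eq_le measure_ge0 andbT -(lebesgue_measure_set1 (angle x)).
  apply: (@le_trans _ _ (circle_measure R [set angle x])).
    apply: le_measure; rewrite ?inE.
    + by apply: measurableI; [exact: pre (measurable_symZ1 x)|].
    + exact: measurable_set1.
    + by move=> y /= [<- og]; rewrite coding_angle.
  rewrite circle_measureE; apply: le_measure; rewrite ?inE.
  + by apply: measurableI; [exact: measurable_set1|exact: measurable_unit_interval].
  + exact: measurable_set1.
  + exact: subIsetl.
Qed.

End CircleFactor.

Theorem mainTheorem4 (R : realType) (k l : nat -> nat) :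
  (forall n, (2 <= k n)%N) -> (forall n, (0 < l n)%N) ->
  (\sum_(0 <= n <oo) (((l n)%:R : R)^-1)%:E < +oo)%E ->
  exists alpha : R,
    [/\ alpha_n k l @ \oo --> alpha,
        ~ (exists r : rat, alpha = ratr r),
        (exists nu : {measure set symZ -> \bar R},
           nonatomic_shift_invariant_prob (circle_factor k l) nu),
        (forall nu1 nu2 : {measure set symZ -> \bar R},
           nonatomic_shift_invariant_prob (circle_factor k l) nu1 ->
           nonatomic_shift_invariant_prob (circle_factor k l) nu2 ->
           forall A : set symZ, measurable A -> nu1 A = nu2 A)
      & (forall nu : {measure set symZ -> \bar R},
           nonatomic_shift_invariant_prob (circle_factor k l) nu ->
           mt_isomorphic (circle_factor k l) nu sh
             unit_interval lebesgue_circle (rotation alpha))].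
Proof.
move=> k2 l0 l_sum.
have l_ge0 n : 0 <= ((l n)%:R : R)^-1 by rewrite invr_ge0.
(* Terms 1 / l_n of at most 1/2 give l_n >= 2 from some level on. *)
have half0 : 0 < 2^-1 :> R by rewrite invr_gt0.
have [n0 hn0] := nneseries_term_small l_ge0 l_sum half0.
pose N := maxn 2 n0; have N2 : (2 <= N)%N := leq_maxl _ _.
have l2 n : (N <= n)%N -> (2 <= l n)%N.
  rewrite geq_max => /andP[_ /hn0]; rewrite lef_pV2 ?posrE ?ltr0n //.
  by rewrite ler_nat.
exists (rot_angle k l R); split.
- exact: (alpha_n_cvg k2 l0).
- exact: (alpha_irrational k2 l0).
- exists (image_measure (circle_measure R) (@measurable_codingR k l R)).
  exact: (coding_measure_prob k2 l0 N2 l2 l_sum).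
- move=> nu1 nu2 h1 h2 A mA.
  by rewrite (coded_measure k2 l0 N2 l2 l_sum h1) // (coded_measure k2 l0 N2 l2 l_sum h2).
- move=> nu h; exact: (circle_factor_isomorphic k2 l0 N2 l2 l_sum h).
Qed.
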